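(* Let $d\ge2$ and let $F_d$ be the free group with free basis $\{a_1,\dots,a_d\}$. If $U$ is a finite generating set of $F_d$ with $|U|=d+1$ that does not contain a commuting pair (i.e. no two distinct elements of $U$ commute), then $$e(F_d,U)\ge\beta_d,$$ where $\beta_d:=e(F_d,\{a_1,a_1a_2,a_2,\ldots,a_d\})$.
   Context: For a group $G$ with a finite generating set $S$, let $B_S(n)$ be the set of elements of $G$ of word length at most $n$ with respect to $S\cup S^{-1}$; the growth rate is $e(G,S):=\lim_{n\to\infty}|B_S(n)|^{1/n}$. *)

(* Defs.v *)
From HB Require Import structures.
From mathcomp Require Import all_boot all_order all_algebra finmap.
From mathcomp Require Import all_classical all_reals all_analysis.

Set Implicit Arguments.
Unset Strict Implicit.
Unset Printing Implicit Defensive.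

Local Open Scope classical_set_scope.

(* Freeness of the family a is the universal property of the free group; it
   implies that a is injective and generates G. *)
Definition free_basis (I : Type) (G : groupType) (a : I -> G) : Prop :=
  forall (H : groupType) (f : I -> H),
    exists2 phi : UMagmaMorphism.type G H,
      forall i, phi (a i) = f i &
      forall psi : UMagmaMorphism.type G H,
        (forall i, psi (a i) = f i) -> psi =1 phi.

(* The condition s \in S or s^-1 \in S says that s is a letter of
   S `|` S^-1. *)
Definition word_ball (G : groupType) (S : {fset G}) (n : nat) : set G :=
  [set x | exists w : seq G,
    [/\ (size w <= n)%N,
        forall s, s \in w -> (s \in S) || ((s^-1)%g \in S) &
        x = (\prod_(s <- w) s)%g]].

Definition generates (G : groupType) (S : {fset G}) : Prop :=
  forall x : G, exists n : nat, word_ball S n x.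

(* word_ball S n is finite, so fset_set loses nothing. The sequence
   converges because #|B(m + n)| <= #|B(m)| * #|B(n)|, so lim is its genuine
   limit; the term at n = 0 is a junk value and is irrelevant. *)
Definition growth_rate (R : realType) (G : groupType) (S : {fset G}) : R :=
  lim ((fun n : nat =>
          powR (#|` fset_set (word_ball S n)|%fset%:R : R)%R (n%:R^-1)%R) @ \oo).

Definition commuting_pair_free (G : groupType) (S : {fset G}) : Prop :=
  forall u v : G, u \in S -> v \in S -> u != v -> ~ commute u v.

(* {a_1, a_1 a_2, a_2, ..., a_d}, with a_1 and a_2 at indices 0 and 1 of 'I_d *)
Definition basis_with_product (d : nat) (hd : (1 < d)%N) (G : groupType)
    (a : 'I_d -> G) : {fset G} :=
  ((a (Ordinal (ltnW hd)) * a (Ordinal hd))%g |` [fset a i | i in 'I_d])%fset.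

(* Main.v *)
(* Magnus' embedding sends the basis element a_i to 1 + X_i in the ring of
   noncommutative power series. Over this ring the left module of relations
   sum_u f_u (u - 1) = 0 between the d + 1 generators is cyclic, with generator
   rho, say. As the ring is a domain, rho_x <> 0 forces the Cayley graph of
   U minus x to be a forest; and if rho had at most two nonzero entries, one
   generator u would satisfy u - 1 = r (v - 1), which forces u and v to commute
   (every polynomial function on F that is right v-invariant is right
   u-invariant, and h |-> h v h^-1 has polynomial coordinates). Hence there are
   x, y, z in U such that removing any one of them from U leaves a forest.

   Counting the edges of these three forests that touch a finite set B gives
   |B (1 + U + U^-1)| >= 2 d |B| + e(B), where e(B) is the number of edges
   inside B whose label is not x, y, z. Along balls this is a linear recursion
   whose dominant eigenvalue b is the positive root of
   b^2 = (2 d - 1) b + 4 (d - 1). For the basis with a_1 a_2 adjoined, counting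
   words without shortcuts of length two gives the matching upper bound. *)

Require Import Defs.
From HB Require Import structures.
From mathcomp Require Import all_boot all_order all_algebra finmap.
From mathcomp Require Import all_classical all_reals all_analysis.
From mathcomp Require Import ring lra zify.

Set Implicit Arguments.
Unset Strict Implicit.
Unset Printing Implicit Defensive.

Import Order.TTheory GRing.Theory Num.Theory.

Local Open Scope ring_scope.

(** * Noncommutative power series *)

Definition series (K : nzRingType) (I : Type) := seq I -> K.

HB.instance Definition _ (K : nzRingType) (I : Type) :=
  Choice.copy (series K I) (seq I -> K).

Section SeriesZmodule.
Variables (K : nzRingType) (I : Type).
Implicit Types f g h : series K I.

Definition series_zero : series K I := fun=> 0.
Definition series_opp f : series K I := fun w => - f w.
Definition series_add f g : series K I := fun w => f w + g w.

Fact series_addA : associative series_add.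
Proof. by move=> f g h; apply/funext => w; exact: addrA. Qed.
Fact series_addC : commutative series_add.
Proof. by move=> f g; apply/funext => w; exact: addrC. Qed.
Fact series_add0 : left_id series_zero series_add.
Proof. by move=> f; apply/funext => w; exact: add0r. Qed.
Fact series_addN : left_inverse series_zero series_opp series_add.
Proof. by move=> f; apply/funext => w; exact: addNr. Qed.

HB.instance Definition _ := GRing.isZmodule.Build (series K I)
  series_addA series_addC series_add0 series_addN.

Lemma seriesDE f g w : (f + g) w = f w + g w. Proof. by []. Qed.
Lemma seriesNE f w : (- f) w = - f w. Proof. by []. Qed.

Lemma series_sumE (J : Type) (r : seq J) (P : pred J) (F : J -> series K I) w :
  (\sum_(j <- r | P j) F j) w = \sum_(j <- r | P j) F j w.
Proof. exact: (big_morph (fun f : series K I => f w)). Qed.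

(** Left division by the letter [i]: [f] is its constant term plus the sum of the X_i
    [deriv i f]. *)
Definition deriv i f : series K I := fun w => f (i :: w).

Lemma derivD i f g : deriv i (f + g) = deriv i f + deriv i g.
Proof. by []. Qed.

(** The Cauchy product, by recursion on the word as in [deriv_mul], so that the ring laws follow by
    induction on words; [seriesME] recovers the sum over splittings. *)
Fixpoint series_mul_rec f g (w : seq I) : K :=
  if w is i :: w' then f [::] * g w + series_mul_rec (deriv i f) g w'
  else f [::] * g [::].

Definition series_mul f g : series K I := series_mul_rec f g.

Definition scale_series (c : K) f : series K I := fun w => c * f w.

Lemma deriv_mul i f g :
  deriv i (series_mul f g) =
  scale_series (f [::]) (deriv i g) + series_mul (deriv i f) g.
Proof. by []. Qed.

Lemma series_mul_nil f g : series_mul f g [::] = f [::] * g [::].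
Proof. by []. Qed.

Lemma series_mul_cons f g i w :
  series_mul f g (i :: w) = f [::] * g (i :: w) + series_mul (deriv i f) g w.
Proof. by []. Qed.

Fact series_mulDl : left_distributive series_mul +%R.
Proof.
move=> f g h; apply/funext => w; elim: w f g => [|i w IH] f g.
  exact: mulrDl.
by rewrite seriesDE !series_mul_cons derivD IH !seriesDE mulrDl addrACA.
Qed.

Fact series_mulDr : right_distributive series_mul +%R.
Proof.
move=> f g h; apply/funext => w; elim: w f => [|i w IH] f.
  exact: mulrDr.
by rewrite seriesDE !series_mul_cons IH !seriesDE mulrDr addrACA.
Qed.

Lemma series_mulZl c f g :
  series_mul (scale_series c f) g = scale_series c (series_mul f g).
Proof.
apply/funext => w; elim: w f => [|i w IH] f; first by rewrite /scale_series mulrA.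
by have := IH (deriv i f); rewrite /scale_series !series_mul_cons mulrDr mulrA => <-.
Qed.

Fact series_mulA : associative series_mul.
Proof.
move=> f g h; apply/funext => w; elim: w f g => [|i w IH] f g.
  exact: mulrA.
rewrite !series_mul_cons deriv_mul series_mulDl series_mulZl seriesDE -IH.
by rewrite series_mul_nil addrA -mulrA mulrDr.
Qed.

Definition series_one : series K I := fun w => (nilp w)%:R.

Fact series_mul1 : left_id series_one series_mul.
Proof.
have mul0 g w : series_mul 0 g w = 0.
  by elim: w => [|i w IH] /=; rewrite /series_mul /= ?mul0r // add0r.
move=> f; apply/funext => -[|i w]; rewrite /series_mul /= mul1r//.
by rewrite [X in _ + X](mul0 f w) addr0.
Qed.

Fact series_mulr1 : right_id series_one series_mul.
Proof.
move=> f; apply/funext => w; elim: w f => [|i w IH] f; first exact: mulr1.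
by have := IH (deriv i f); rewrite /series_mul /= => ->; rewrite mulr0 add0r.
Qed.

Fact series_one_neq0 : series_one != 0 :> series K I.
Proof. by apply/eqP => /(congr1 (@^~ [::])) /eqP; rewrite oner_eq0. Qed.

HB.instance Definition _ := GRing.Zmodule_isNzRing.Build (series K I)
  series_mulA series_mul1 series_mulr1 series_mulDl series_mulDr series_one_neq0.

Lemma seriesM_nil f g : (f * g) [::] = f [::] * g [::].
Proof. by []. Qed.

Lemma seriesM_cons f g i w :
  (f * g) (i :: w) = f [::] * g (i :: w) + (deriv i f * g) w.
Proof. by []. Qed.

Lemma series1_cons i w : (1 : series K I) (i :: w) = 0. Proof. by []. Qed.
Lemma deriv1 i : deriv i 1 = 0. Proof. by []. Qed.

Lemma scale_seriesMl c f g : scale_series c f * g = scale_series c (f * g).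
Proof. exact: series_mulZl. Qed.

Lemma seriesME f g w :
  (f * g) w = \sum_(j < (size w).+1) f (take j w) * g (drop j w).
Proof.
elim: w f => [|i w IH] f; first by rewrite big_ord_recl big_ord0 addr0.
by rewrite seriesM_cons big_ord_recl /= IH.
Qed.

End SeriesZmodule.

(** * Absence of zero divisors *)

Section SeriesDomain.
Variables (K : idomainType) (I : Type).
Implicit Types f g : series K I.

(** The coefficient of the product at [v] is the constant term of [f] times [g v], plus terms at
    shorter suffixes of [v], where [g] vanishes by induction. *)
Lemma series_mul_eq0_nil f g : f [::] != 0 -> f * g = 0 -> g = 0.
Proof.
move=> f0 fg; apply/funext => v.
elim/ltn_ind: {v}(size v) {-2}v (erefl (size v)) => m IHm v sv.
have /eqP := congr1 (@^~ v) fg; rewrite seriesME big_ord_recl take0 drop0 big1.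
  by rewrite addr0 mulf_eq0 (negPf f0) => /eqP.
move=> j _; rewrite [X in _ * X](IHm (size (drop (lift ord0 j) v))) ?mulr0//.
by rewrite size_drop -sv /= /bump; case: j => j /=; lia.
Qed.

(** As long as [f] has no constant term, the first letter of a word in its support can be stripped,
    since then [deriv i (f * g) = deriv i f * g]. *)
Lemma series_mul_eq0 f g : f <> 0 -> f * g = 0 -> g = 0.
Proof.
move=> f0 fg; have [w fw] : exists w, f w != 0.
  by apply: contrapT => /forallNP H; apply: f0; apply/funext => w; apply/eqP/negPn/negP.
elim: w f {f0} fw fg => [|i w IH] f fw fg; first exact: series_mul_eq0_nil fw fg.
have [f0|f0] := eqVneq (f [::]) 0; last exact: series_mul_eq0_nil f0 fg.
apply: (IH (deriv i f)) => //; apply/funext => v.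
by have := congr1 (@^~ (i :: v)) fg; rewrite seriesM_cons f0 mul0r add0r.
Qed.

End SeriesDomain.

(** * The group of units of the ring of series *)

Section SeriesUnits.
Variables (K : nzRingType) (I : eqType).

(** A unit is stored together with its inverse, which makes the units a [groupType], as the
    universal property asks of its target. *)
Definition series_unit_pred : pred (series K I * series K I) :=
  fun p => (p.1 * p.2 == 1) && (p.2 * p.1 == 1).

Definition series_unit := {p | series_unit_pred p}.

HB.instance Definition _ := Choice.copy series_unit {p | series_unit_pred p}.

Fact series_unit1_subproof : series_unit_pred (1, 1).
Proof. by rewrite /series_unit_pred /= mulr1 eqxx. Qed.

Fact series_unitM_subproof (x y : series_unit) :
  series_unit_pred ((val x).1 * (val y).1, (val y).2 * (val x).2).
Proof.
case: x y => -[f f'] /= /andP[/= /eqP fK /eqP fK'] [[g g'] /= /andP[/= /eqP gK /eqP gK']].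
apply/andP; split; rewrite /= mulrA.
  by rewrite -(mulrA f g) gK mulr1 fK.
by rewrite -(mulrA g' f') fK' mulr1 gK'.
Qed.

Fact series_unitV_subproof (x : series_unit) :
  series_unit_pred ((val x).2, (val x).1).
Proof. by case: x => -[f f'] /= /andP[/= ? ?]; apply/andP. Qed.

Definition series_unit1 : series_unit := Sub _ series_unit1_subproof.
Definition series_unitM x y : series_unit := Sub _ (series_unitM_subproof x y).
Definition series_unitV x : series_unit := Sub _ (series_unitV_subproof x).

Fact series_unitMA : associative series_unitM.
Proof. by move=> x y z; apply/val_inj; rewrite !SubK /= !mulrA. Qed.
Fact series_unitM1 : left_id series_unit1 series_unitM.
Proof. by move=> x; apply/val_inj; rewrite !SubK /= mul1r mulr1; case: (val x). Qed.
Fact series_unitMr1 : right_id series_unit1 series_unitM.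
Proof. by move=> x; apply/val_inj; rewrite !SubK /= mul1r mulr1; case: (val x). Qed.
Fact series_unitMV : left_inverse series_unit1 series_unitV series_unitM.
Proof.
move=> x; apply/val_inj; rewrite !SubK /=.
by case: x => -[f f'] /= /andP[/= _ /eqP ->].
Qed.
Fact series_unitMrV : right_inverse series_unit1 series_unitV series_unitM.
Proof.
move=> x; apply/val_inj; rewrite !SubK /=.
by case: x => -[f f'] /= /andP[/= /eqP -> _].
Qed.

HB.instance Definition _ := isGroup.Build series_unit series_unitMA series_unitM1
  series_unitMr1 series_unitMV series_unitMrV.

Definition seriesX i : series K I := fun w => (w == [:: i])%:R.

(** The sum of all (-X_i)^n, that is, the inverse of 1 + X_i. *)
Definition geometric_series i : series K I :=
  fun w => if all (pred1 i) w then (-1) ^+ size w else 0.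

Lemma deriv_X i j : deriv j (seriesX i) = (j == i)%:R.
Proof.
apply/funext => w; rewrite /deriv /seriesX eqseq_cons.
by case: (j == i) => //; rewrite /= -?[RHS]/((nilp w)%:R) //; case: w.
Qed.

Lemma deriv_1X i j : deriv j (1 + seriesX i) = (j == i)%:R.
Proof. by rewrite derivD deriv1 add0r deriv_X. Qed.

Lemma deriv_geometric i j :
  deriv j (geometric_series i) = if j == i then - geometric_series i else 0.
Proof.
apply/funext => w; rewrite /deriv /geometric_series /=.
case: eqP => _ //=; rewrite seriesNE.
by case: ifP => _; rewrite ?oppr0 // exprS mulN1r.
Qed.

Lemma mul_1X_geometric i : (1 + seriesX i) * geometric_series i = 1.
Proof.
apply/funext => -[|j w]; first by rewrite seriesM_nil seriesDE addr0 mul1r.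
rewrite seriesM_cons seriesDE addr0 mul1r deriv_1X series1_cons.
rewrite -[geometric_series i (j :: w)]/(deriv j (geometric_series i) w) deriv_geometric.
by case: (j == i); rewrite ?mul1r ?mul0r ?addr0// seriesNE addNr.
Qed.

Lemma mul_geometric_1X i : geometric_series i * (1 + seriesX i) = 1.
Proof.
apply/funext => w; elim: w => [|j w IH]; first by rewrite seriesM_nil seriesDE addr0 mul1r.
rewrite seriesM_cons series1_cons -[geometric_series i [::]]/(1 : K) mul1r.
rewrite -[(1 + seriesX i) (j :: w)]/(deriv j (1 + seriesX i) w).
rewrite deriv_1X deriv_geometric.
case: (j == i); last by rewrite mul0r addr0.
by rewrite mulNr seriesNE IH subrr.
Qed.

Lemma unit_1X_subproof i : series_unit_pred (1 + seriesX i, geometric_series i).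
Proof. by apply/andP; rewrite /= mul_1X_geometric mul_geometric_1X. Qed.

End SeriesUnits.

(** * Induction along a free basis *)

Section FreeBasis.
Variables (I : Type) (F : groupType) (a : I -> F).
Hypothesis ha : free_basis a.

Section Induction.
Variable P : F -> Prop.
Hypotheses (P1 : P 1%g) (Pa : forall i g, P g -> P (a i * g)%g).
Hypothesis PV : forall i g, P g -> P ((a i)^-1 * g)%g.

(* A subgroup containing all the a i; it is the whole of F because the
   endomorphism of F factoring through it can only be the identity. *)
Let stab : pred F := fun x => `[< forall g, P (x * g)%g <-> P g >].
Let stab_type := {x | stab x}.
#[local] HB.instance Definition _ := SubChoice.copy stab_type {x | stab x}.

Fact stab_closed : group_closed stab.
Proof.
split=> [|x y]; first by apply/asboolP => g; rewrite mul1g.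
move=> /asboolP Px /asboolP Py; apply/asboolP => g.
rewrite -mulgA; apply: iff_trans (Px _) _; apply: iff_sym.
by have := Py (y^-1 * g)%g; rewrite mulVKg.
Qed.

#[local] HB.instance Definition _ :=
  SubChoice_isSubGroup.Build F stab stab_type stab_closed.

Lemma free_basis_ind g : P g.
Proof.
have stab_a i : stab (a i).
  by apply/asboolP => h; split=> [/(PV i)|/(Pa i)//]; rewrite mulKg.
have [phi phiE _] := ha (fun i => Sub (a i) (stab_a i) : stab_type).
have [phi0 _ uniq] := ha a.
have e : val (phi g) = g.
  transitivity (phi0 g).
    by apply: (uniq [the UMagmaMorphism.type F F of val \o phi]) => i /=; rewrite phiE.
  by apply/esym/(uniq [the UMagmaMorphism.type F F of idfun]).
have := valP (phi g); rewrite e => /asboolP /(_ 1%g).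
by rewrite mulg1 => -[_]; apply.
Qed.

End Induction.
End FreeBasis.

Definition magnus_hom (K : nzRingType) (I : eqType) (F : groupType) (a : I -> F)
    (M : F -> series K I) :=
  [/\ M 1%g = 1, forall g h, M (g * h)%g = M g * M h
    & forall i, M (a i) = 1 + seriesX K i].

Lemma magnus_hom_exists (K : nzRingType) (I : eqType) (F : groupType) (a : I -> F) :
  free_basis a -> exists M : F -> series K I, magnus_hom a M.
Proof.
move=> ha; have [phi phiE _] :=
  ha (series_unit K I) (fun i => Sub _ (unit_1X_subproof K i)).
exists (fun g => (val (phi g)).1); split=> [|g h|i].
- by rewrite gmulf1.
- by rewrite gmulfM.
- by rewrite phiE SubK.
Qed.

(** * The Magnus embedding *)

Section Infiltration.
Variable I : eqType.

(** The infiltration product of Chen, Fox and Lyndon, as a list with multiplicities: shuffles of two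
    words in which equal letters may also be merged. *)
Fixpoint infiltration (u : seq I) : seq I -> seq (seq I) :=
  if u is i :: u' then
    fix infiltration_u v := if v is j :: v' then
      [seq i :: t | t <- infiltration u' v] ++ [seq j :: t | t <- infiltration_u v'] ++
      (if i == j then [seq i :: t | t <- infiltration u' v'] else [::])
    else [:: u]
  else fun v => [:: v].

Arguments infiltration : simpl never.

Lemma infiltration_nil_l v : infiltration [::] v = [:: v].
Proof. by []. Qed.

Lemma infiltration_cons i u j v :
  infiltration (i :: u) (j :: v) =
  [seq i :: t | t <- infiltration u (j :: v)] ++
  [seq j :: t | t <- infiltration (i :: u) v] ++
  (if i == j then [seq i :: t | t <- infiltration u v] else [::]).
Proof. by []. Qed.

Lemma infiltration_nil_r u : infiltration u [::] = [:: u].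
Proof. by case: u. Qed.

Variable K : comNzRingType.
Implicit Types f : series K I.

(** Group-likeness for the coproduct that makes every 1 + X_i group-like; infiltration is the
    product dual to it. *)
Definition grouplike f :=
  f [::] = 1 /\ forall u v, f u * f v = \sum_(t <- infiltration u v) f t.

Lemma sum_infiltration_cons f i u j v :
  \sum_(t <- infiltration (i :: u) (j :: v)) f t =
  \sum_(t <- infiltration u (j :: v)) f (i :: t) +
  \sum_(t <- infiltration (i :: u) v) f (j :: t) +
  (i == j)%:R * \sum_(t <- infiltration u v) f (i :: t).
Proof.
rewrite infiltration_cons !big_cat !big_map /= addrA; congr (_ + _).
by case: (i == j); rewrite ?big_map ?mul1r // mul0r big_nil.
Qed.

Variables (k : I) (f f' : series K I).
Hypotheses (f'0 : f' [::] = f [::]).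
Hypothesis f'S : forall i w, f' (i :: w) = f (i :: w) + (i == k)%:R * f w.

Let sum_f' i u j v :
  \sum_(t <- infiltration (i :: u) (j :: v)) f' t =
  \sum_(t <- infiltration (i :: u) (j :: v)) f t +
  (i == k)%:R * (\sum_(t <- infiltration u (j :: v)) f t) +
  (j == k)%:R * (\sum_(t <- infiltration (i :: u) v) f t) +
  (i == k)%:R * (j == k)%:R * \sum_(t <- infiltration u v) f t.
Proof.
rewrite !sum_infiltration_cons.
have e l r : \sum_(t <- r) f' (l :: t) =
    \sum_(t <- r) f (l :: t) + (l == k)%:R * \sum_(t <- r) f t.
  by under eq_bigr do rewrite f'S; rewrite big_split /= -big_distrr.
rewrite !e; case: (eqVneq i j) => [->|nij].
  case: (j == k) => /=; ring.
have -> : (i == k)%:R * (j == k)%:R = 0 :> K.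
  by case: (eqVneq i k) nij => [->|]; rewrite ?mul0r // eq_sym => /negPf ->; rewrite mulr0.
by rewrite /= !mul0r !addr0; ring.
Qed.

(** The hypotheses on [f'] say that it is (1 + X_k) [f]. Both directions are needed, since inverses
    of basis elements are handled by the converse. *)
Lemma grouplike_1XM : grouplike f <-> grouplike f'.
Proof.
split=> -[f0 fM]; (split; first by rewrite -f0 f'0).
- case=> [|i u] v; first by rewrite infiltration_nil_l big_seq1 f'0 f0 mul1r.
  case: v => [|j v]; first by rewrite big_seq1 f'0 f0 mulr1.
  by rewrite sum_f' -!fM !f'S; ring.
(* Besides the wanted sum, [sum_f'] has only sums for shorter pairs of words; induction turns them
   into products, which cancel. *)
- move=> u v; elim/ltn_ind: {u v}(size u + size v)%N {-2}u {-2}v (erefl (size u + size v)%N).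
  move=> n IH [|i u] v nE; first by rewrite infiltration_nil_l big_seq1 -f'0 f0 mul1r.
  case: v nE => [|j v] nE; first by rewrite big_seq1 -f'0 f0 mulr1.
  have := fM (i :: u) (j :: v); rewrite sum_f' !f'S.
  rewrite -(IH _ _ u (j :: v) erefl) -?(IH _ _ (i :: u) v erefl) -?(IH _ _ u v erefl).
  + by move=> e; apply: (addIr ((i == k)%:R * (f u * f (j :: v)) +
      (j == k)%:R * (f (i :: u) * f v) + (i == k)%:R * (j == k)%:R * (f u * f v)));
      rewrite !addrA -e; ring.
  + by rewrite -nE /=; lia.
  + by rewrite -nE /=; lia.
  + by rewrite -nE /=; lia.
Qed.

End Infiltration.

(** * Injectivity and linear independence of the Magnus images *)

Section Magnus.
Variables (K : numFieldType) (I : eqType) (F : groupType) (a : I -> F).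
Variable M : F -> series K I.
Hypotheses (ha : free_basis a) (hM : magnus_hom a M).

Lemma magnus1 : M 1%g = 1. Proof. by case: hM. Qed.
Lemma magnusM g h : M (g * h)%g = M g * M h. Proof. by case: hM. Qed.

Lemma magnus_aM_nil i g : M (a i * g)%g [::] = M g [::].
Proof. by case: hM => _ -> ->; rewrite seriesM_nil seriesDE addr0 mul1r. Qed.

Lemma magnus_aM_cons i g j w :
  M (a i * g)%g (j :: w) = M g (j :: w) + (j == i)%:R * M g w.
Proof.
case: hM => _ -> ->; rewrite seriesM_cons seriesDE addr0 mul1r deriv_1X.
by case: (j == i); rewrite ?mul1r ?mul0r.
Qed.

Lemma grouplike_magnus g : grouplike (M g).
Proof.
elim/(free_basis_ind ha): g => [|i g|i g IH].
- rewrite magnus1; split=> [//|[|i u] v].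
    by rewrite infiltration_nil_l big_seq1 mul1r.
  case: v => [|j v]; first by rewrite infiltration_nil_r big_seq1 mulr1.
  rewrite sum_infiltration_cons !big1 ?mulr0 ?addr0//.
- by apply: (grouplike_1XM (magnus_aM_nil i g) (magnus_aM_cons i g)).1.
- apply: (grouplike_1XM (magnus_aM_nil i _) (magnus_aM_cons i _)).2.
  by rewrite mulVKg.
Qed.

Lemma magnus_nil g : M g [::] = 1. Proof. by case: (grouplike_magnus g). Qed.

Lemma magnus_mul g u v : M g u * M g v = \sum_(t <- infiltration u v) M g t.
Proof. by case: (grouplike_magnus g) => _; apply. Qed.

Definition zpow (x : F) (n : int) : F :=
  match n with Posz m => x ^+ m | Negz m => x ^- m.+1 end%g.

Lemma zpowS x n : (zpow x (n + 1) = x * zpow x n)%g.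
Proof.
case: n => [m|[|m]]; first by rewrite -PoszD addn1 /= expgS.
  by rewrite /= mulgV.
have -> : Negz m.+1 + 1 = Negz m by rewrite !NegzE; lia.
by rewrite /= -!expVgn [X in (_ * X)%g]expgS mulVKg.
Qed.

Lemma zpow_pred x n : (zpow x (n - 1) = x^-1 * zpow x n)%g.
Proof. by rewrite -{2}[n](subrK 1) zpowS mulKg. Qed.

(** Left multiplication by 1 + X_i changes only coefficients of words that start with [i]. The
    default of [head] is [i], so the empty word needs its own case. *)
Lemma magnus_zpowM_neq i n g w :
  head i w != i \/ w = [::] -> M (zpow (a i) n * g)%g w = M g w.
Proof.
move=> hw; have step h : M (a i * h)%g w = M h w.
  case: w hw => [_|j w []//= /negPf ji]; first exact: magnus_aM_nil.
  by rewrite magnus_aM_cons ji mul0r addr0.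
elim/int_rec: n => [|n IH|n IH]; first by rewrite /= mul1g.
  by rewrite -addn1 PoszD zpowS -mulgA step.
by rewrite -addn1 PoszD opprD zpow_pred -IH -step -mulgA mulVKg.
Qed.

(** Since [w] does not start with [i], only the terms 1 + n X_i of (1 + X_i)^n contribute at
    [i :: w]. *)
Lemma magnus_zpowM_eq i n g w : head i w != i \/ w = [::] ->
  M (zpow (a i) n * g)%g (i :: w) = M g (i :: w) + n%:~R * M g w.
Proof.
move=> hw; elim/int_rec: n => [|n IH|n IH]; first by rewrite /= mul1g mul0r addr0.
  rewrite -addn1 PoszD zpowS -mulgA magnus_aM_cons eqxx IH (magnus_zpowM_neq _ _ hw).
  by rewrite rmorphD /=; ring.
have := magnus_aM_cons i (zpow (a i) (- n.+1%:Z) * g)%g i w.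
rewrite -{1}addn1 PoszD opprD zpow_pred !mulgA mulgV mul1g eqxx IH.
rewrite (magnus_zpowM_neq _ _ hw) => /esym/(canRL (addrK _)) ->.
by rewrite !mulrNz -addn1 PoszD rmorphD /=; ring.
Qed.

Definition syllables (l : seq (I * int)) : F :=
  (foldr (fun p g => zpow (a p.1) p.2 * g) 1 l)%g.

Let alternating (w : seq I) := sorted (fun i j => j != i) w.

(** Left multiplication by a basis element or its inverse adds a syllable or changes the first
    exponent; a syllable whose exponent becomes 0 is dropped. *)
Lemma syllables_exists g : exists2 l, syllables l = g &
  alternating (map fst l) && all (fun p : I * int => p.2 != 0) l.
Proof.
have step i (n : int) h : n != 0 ->
    (forall m : int, zpow (a i) (m + n) = zpow (a i) n * zpow (a i) m)%g ->
    (exists2 l, syllables l = h & alternating (map fst l) && all (fun p : I * int => p.2 != 0) l) ->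
  exists2 l, (syllables l = zpow (a i) n * h)%g &
    alternating (map fst l) && all (fun p : I * int => p.2 != 0) l.
  move=> n0 nD [[|[j m] l] <- /andP[]]; first by move=> _ _; (exists [:: (i, n)]); rewrite //= ?n0.
  have [->{j}|ji] := eqVneq j i; last first.
    by move=> /= alt /andP[m0 l0]; (exists [:: (i, n), (j, m) & l]); rewrite //= ji alt n0 m0.
  move=> alt /= /andP[m0 l0]; have [mn|mn] := eqVneq (m + n) 0.
    exists l; first by rewrite mulgA -nD mn mul1g.
    by rewrite l0 andbT; move: alt; rewrite /alternating /=; apply: path_sorted.
  exists ((i, m + n) :: l); first by rewrite /= nD mulgA.
  by rewrite /= mn l0 !andbT; exact: alt.
elim/(free_basis_ind ha): g => [|i g|i g]; first by exists [::].
  by apply: (step i 1) => // m; rewrite zpowS.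
have -> : ((a i)^-1 = zpow (a i) (-1))%g by [].
by apply: (step i (-1)) => // m; rewrite zpow_pred.
Qed.

Lemma alternating_head i w : alternating (i :: w) -> head i w != i \/ w = [::].
Proof. by case: w => [|j w]; [right|left; case/andP: H]. Qed.

(** Each syllable is a series in a single letter, so it supplies at most one letter of an
    alternating word. *)
Lemma magnus_syllables_long l w : alternating w -> (size l < size w)%N ->
  M (syllables l) w = 0.
Proof.
elim: l w => [|[i n] l IH] [|j w] // alt; first by rewrite magnus1.
rewrite /= ltnS => sz; have [ji|ji] := eqVneq j i; last first.
  by rewrite magnus_zpowM_neq ?IH //=; [lia|left].
rewrite ji in alt *; rewrite magnus_zpowM_eq ?IH ?mulr0 ?addr0//; try by rewrite /=; lia.
  exact: path_sorted alt.
exact: alternating_head.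
Qed.

(** By the same count every syllable supplies exactly one letter, through its linear term n X_i. *)
Lemma magnus_syllables l : alternating (map fst l) ->
  M (syllables l) (map fst l) = \prod_(p <- l) p.2%:~R.
Proof.
elim: l => [_|[i n] l IH alt]; first by rewrite big_nil magnus_nil.
rewrite big_cons /= magnus_zpowM_eq; last exact: alternating_head.
rewrite (magnus_syllables_long alt) ?add0r ?IH//=; last by rewrite size_map.
exact: path_sorted alt.
Qed.

(** A nonempty reduced form of [g^-1 * h] would give a nonzero coefficient, the product of its
    exponents, at a nonempty word, where the series 1 has none. *)
Lemma magnus_inj : injective M.
Proof.
move=> g h gh; have [[|p l]] := syllables_exists (g^-1 * h)%g.
  by move=> /(congr1 (fun x => g * x)%g); rewrite mulVKg mulg1.
move=> lE /andP[alt l0]; have := magnus_syllables alt.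
rewrite lE magnusM -gh -magnusM mulVg magnus1 series1_cons => /esym/eqP.
rewrite prodf_seq_eq0 => /hasP[q ql] /=; rewrite intr_eq0.
by move/allP: l0 => /(_ _ ql) /negPf ->.
Qed.

(* The infiltration product makes the annihilator of the M g stable under
   c |-> (fun g => c g * M g w), so c can be multiplied by a coefficient
   difference that kills g0. *)
Lemma magnus_free (r : seq F) (c : F -> K) : uniq r ->
  (forall w, \sum_(g <- r) c g * M g w = 0) -> forall g, g \in r -> c g = 0.
Proof.
elim: r c => [//|g0 r IH] c /= /andP[g0r ur] c0.
have cr g : g \in r -> c g = 0.
  move=> gr; have [w gw] : exists w, M g w != M g0 w.
    apply: contrapT => /forallNP H; move: g0r; rewrite -(_ : g = g0) ?gr//.
    by apply: magnus_inj; apply/funext => w; apply/eqP/negPn/negP.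
  have := IH (fun g => c g * (M g w - M g0 w)) ur _ g gr.
  move=> /(_ _)/eqP; rewrite mulf_eq0 subr_eq0 (negPf gw) orbF => cg.
  apply/eqP/cg => v.
  have c0w u : \sum_(g <- r) c g * M g u = - (c g0 * M g0 u).
    by have := c0 u; rewrite big_cons => /eqP; rewrite addrC addr_eq0 => /eqP.
  under eq_bigr do rewrite -mulrA mulrBl [_ * M _ v]magnus_mul mulrBr !mulr_sumr.
  rewrite sumrB exchange_big /=; under eq_bigr do rewrite c0w.
  under [X in _ - X]eq_bigr do rewrite mulrCA.
  by rewrite -mulr_sumr c0w sumrN -mulr_sumr -magnus_mul; ring.
move=> g; rewrite inE => /orP[/eqP->|/cr//].
have := c0 [::]; rewrite big_cons magnus_nil mulr1 big_seq big1 ?addr0//.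
by move=> h /cr ->; rewrite mul0r.
Qed.

End Magnus.

(** * Relations between generators *)

Section RelationModule.
Variables (K : fieldType) (n : nat) (c : 'I_n.+1 -> series K 'I_n).
Hypothesis c0 : forall j, c j [::] = 0.

Let A : 'M[K]_(n.+1, n) := \matrix_(j, i) c j [:: i].
Hypothesis A_full : row_full A.

Section Solve.
Variable B : 'M[K]_(n, n.+1).

(** The constant terms of the solution, which are determined through [B] by the linear part of
    [h]. *)
Definition solve0 (h : series K 'I_n) j := \sum_i h [:: i] * B i j.

(* Stripping a letter i from sum_j s_j c_j = h gives an equation of the same form
   for the derivatives of the s_j, since the c_j have no constant term. *)
Fixpoint solve_rec (w : seq 'I_n) (h : series K 'I_n) j : K :=
  if w is i :: w' then
    solve_rec w' (deriv i h - \sum_l scale_series (solve0 h l) (deriv i (c l))) j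
  else solve0 h j.

Definition solve h j : series K 'I_n := fun w => solve_rec w h j.

Hypothesis BA : B *m A = 1%:M.

Lemma solve0A (h : series K 'I_n) i : \sum_l solve0 h l * c l [:: i] = h [:: i].
Proof.
under eq_bigr do rewrite mulr_suml; rewrite exchange_big /= (bigD1 i)//=.
have e k : \sum_l h [:: k] * B k l * c l [:: i] = h [:: k] * (k == i)%:R.
  have /matrixP/(_ k i) := BA; rewrite !mxE => <-; rewrite mulr_sumr.
  by apply: eq_bigr => l _; rewrite mxE mulrA.
rewrite e eqxx mulr1 big1 ?addr0// => k /negPf ki.
by rewrite e ki mulr0.
Qed.

Lemma solveP h : h [::] = 0 -> \sum_j solve h j * c j = h.
Proof.
move=> h0; apply/funext => w; elim: w h h0 => [|i w IH] h h0; rewrite series_sumE.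
  by rewrite h0 big1// => j _; rewrite seriesM_nil c0 mulr0.
under eq_bigr do rewrite seriesM_cons; rewrite big_split /=.
(* [h'] has no constant term because [B] is a left inverse of the matrix [A] of linear parts. *)
set h' := deriv i h - \sum_l scale_series (solve0 h l) (deriv i (c l)).
have := IH h'; rewrite series_sumE => -> /=.
  by rewrite /h' seriesDE seriesNE series_sumE addrC subrK.
by rewrite /h' seriesDE seriesNE series_sumE /= [X in _ - X]solve0A subrr.
Qed.

(** A zero column in [B] keeps the corresponding generator out of the solution; this expresses one
    generator through the others. *)
Lemma solve_eq0 h j : (forall i, B i j = 0) -> solve h j = 0.
Proof.
move=> Bj; apply/funext => w; elim: w h => [|i w IH] h; last exact: IH.
by apply: big1 => i _; rewrite Bj mulr0.
Qed.

End Solve.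

(** The linear parts satisfy one relation [lam] up to scalars. If [lam] is nonzero at [j0], the
    other generators express [c j0], which gives [rho] with [rho j0 = 1], and a relation is
    determined by its entry at [j0]. *)
Lemma relation_module_cyclic : exists2 rho : 'I_n.+1 -> series K 'I_n,
  (exists j, rho j = 1) /\ \sum_j rho j * c j = 0 &
  forall f, \sum_j f j * c j = 0 -> exists s, forall j, f j = s * rho j.
Proof.
have rkA : \rank A = n by apply/eqP.
have rk_ker : \rank (kermx A) = 1 by rewrite mxrank_ker rkA subSnn.
have /rowV0Pn[lam lam_ker lam0] : kermx A != 0 by rewrite -mxrank_eq0 rk_ker.
have lamA : lam *m A = 0 by apply/sub_kermxP.
have [j0 lj0] : exists j, lam 0 j != 0.
  apply/existsP; apply: contraNT lam0 => /existsPn H.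
  by apply/eqP/rowP => j; rewrite mxE; apply/eqP/negPn.
have kerA (v : 'rV[K]_n.+1) : v *m A = 0 -> v 0 j0 = 0 -> v = 0.
  move=> /sub_kermxP vA vj0.
  have /eqmxP lker : (lam :=: kermx A)%MS.
    by apply/eqmxP; rewrite -(geq_leqif (mxrank_leqif_eq lam_ker)) rk_ker rank_rV lam0.
  have /sub_rVP[t vt] : (v <= lam)%MS by rewrite (eqmxP lker).
  move: vj0; rewrite vt mxE => /eqP.
  by rewrite mulf_eq0 (negPf lj0) orbF => /eqP ->; rewrite scale0r.
have [B0 B0A] := row_fullP A_full.
(* A multiple of [lam] is subtracted from each row of [B0] to clear column [j0]; as [lam *m A = 0],
   a left inverse remains. *)
pose B : 'M[K]_(n, n.+1) := B0 - (lam 0 j0)^-1 *: (col j0 B0 *m lam).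
have BA : B *m A = 1%:M.
  by rewrite mulmxBl B0A -scalemxAl -mulmxA lamA mulmx0 scaler0 subr0.
have Bj0 i : B i j0 = 0.
  by rewrite !mxE big_ord1 !mxE mulrCA mulVf // mulr1 subrr.
(* The linear coefficients of a relation put its constant terms in the kernel of [A]; they vanish by
   [kerA], and the relation then passes to the derivatives. *)
have uniq_nil f : \sum_j f j * c j = 0 -> f j0 = 0 -> forall l, f l [::] = 0.
  move=> fc fj0 l; have := kerA (\row_j f j [::]).
  rewrite mxE fj0 => /(_ _ erefl)/rowP/(_ l); rewrite !mxE; apply.
  apply/rowP => i; rewrite !mxE.
  transitivity ((\sum_j f j * c j) [:: i]); last by rewrite fc.
  rewrite series_sumE; apply: eq_bigr => m _.
  by rewrite seriesM_cons seriesM_nil c0 mulr0 addr0 !mxE.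
have uniq f : \sum_j f j * c j = 0 -> f j0 = 0 -> forall j, f j = 0.
  move=> fc fj0 j; apply/funext => w; elim: w f fc fj0 j => [|i w IH] f fc fj0 j.
    exact: uniq_nil.
  apply: (IH (fun l => deriv i (f l))); last by rewrite fj0.
  apply/funext => v; transitivity ((\sum_j f j * c j) (i :: v)); last by rewrite fc.
  rewrite !series_sumE; apply: eq_bigr => l _.
  by rewrite seriesM_cons uniq_nil // mul0r add0r.
pose rho j : series K 'I_n := (j == j0)%:R - solve B (c j0) j.
have rhoj0 : rho j0 = 1 by rewrite /rho eqxx solve_eq0 ?subr0.
have rhoc : \sum_j rho j * c j = 0.
  under eq_bigr do rewrite mulrBl; rewrite sumrB solveP //.
  rewrite (bigD1 j0) //= eqxx mul1r big1 ?addr0 ?subrr// => j /negPf ->.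
  by rewrite mul0r.
exists rho; first by split=> //; exists j0.
move=> f fc; exists (f j0) => j; apply/eqP; rewrite -subr_eq0; apply/eqP.
move: j; apply: uniq; last by rewrite rhoj0 mulr1 subrr.
under eq_bigr do rewrite mulrBl -mulrA.
by rewrite sumrB fc -mulr_sumr rhoc mulr0 subrr.
Qed.

End RelationModule.

(** * Polynomial functions on the group and commutation *)

Section Centralizer.
Variables (K : numFieldType) (I : finType) (F : groupType) (a : I -> F).
Variable M : F -> series K I.
Hypotheses (ha : free_basis a) (hM : magnus_hom a M).

Definition poly_fun (psi : F -> K) := exists l : seq (K * seq I),
  forall h, psi h = \sum_(p <- l) p.1 * M h p.2.

Lemma poly_fun_coef w : poly_fun (fun h => M h w).
Proof. by exists [:: (1, w)] => h; rewrite big_seq1 mul1r. Qed.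

Lemma poly_funZ c psi : poly_fun psi -> poly_fun (fun h => c * psi h).
Proof.
move=> [l lE]; exists [seq (c * p.1, p.2) | p <- l] => h.
by rewrite big_map lE mulr_sumr; apply: eq_bigr => p _; rewrite mulrA.
Qed.

Lemma poly_fun_sum (J : Type) (r : seq J) (psi : J -> F -> K) :
  (forall j, poly_fun (psi j)) -> poly_fun (fun h => \sum_(j <- r) psi j h).
Proof.
move=> H; elim: r => [|j r [l lE]]; first by exists [::] => h; rewrite !big_nil.
have [l' l'E] := H j; exists (l' ++ l) => h.
by rewrite big_cons big_cat lE l'E.
Qed.

(** Products of Magnus coefficients are sums of Magnus coefficients, by infiltration. *)
Lemma poly_funM psi psi' :
  poly_fun psi -> poly_fun psi' -> poly_fun (fun h => psi h * psi' h).
Proof.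
move=> [l lE] [l' l'E].
have -> : (fun h => psi h * psi' h) = fun h => \sum_(p <- l) \sum_(q <- l')
    (p.1 * q.1) * \sum_(t <- infiltration p.2 q.2) M h t.
  apply/funext => h; rewrite lE l'E mulr_suml; apply: eq_bigr => p _.
  rewrite mulr_sumr; apply: eq_bigr => q _.
  by rewrite -(magnus_mul ha hM) mulrACA.
apply: poly_fun_sum => p; apply: poly_fun_sum => q; apply: poly_funZ.
by apply: poly_fun_sum => t; exact: poly_fun_coef.
Qed.

(** The equation [M h * M h^-1 = 1] expresses a coefficient of [M h^-1] through those at shorter
    words. *)
Lemma poly_fun_inv w : poly_fun (fun h => M h^-1%g w).
Proof.
elim/ltn_ind: {w}(size w) {-2}w (erefl (size w)) => m IH [|i w] sw.
  by exists [:: (1, [::])] => h; rewrite big_seq1 !(magnus_nil ha hM) mulr1.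
have -> : (fun h => M h^-1%g (i :: w)) = fun h => (-1) * \sum_(j < (size w).+1)
    M h (take j.+1 (i :: w)) * M h^-1%g (drop j.+1 (i :: w)).
  apply/funext => h; have : (M h * M h^-1%g) (i :: w) = 0.
    by rewrite -(magnusM hM) mulgV (magnus1 hM).
  rewrite seriesME big_ord_recl take0 drop0 (magnus_nil ha hM) mul1r => /eqP.
  by rewrite addr_eq0 mulN1r => /eqP ->.
apply: poly_funZ; apply: poly_fun_sum => j; apply: poly_funM.
  exact: poly_fun_coef.
by apply: (IH (size (drop j.+1 (i :: w)))); rewrite // -sw size_drop /=; lia.
Qed.

Lemma poly_fun_conj v w : poly_fun (fun h => M (h * v * h^-1)%g w).
Proof.
have -> : (fun h => M (h * v * h^-1)%g w) = fun h => \sum_(j < (size w).+1)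
    M h (take j w) * \sum_(k < (size (drop j w)).+1)
      M v (take k (drop j w)) * M h^-1%g (drop k (drop j w)).
  apply/funext => h; rewrite -mulgA !(magnusM hM) seriesME.
  by apply: eq_bigr => j _; rewrite seriesME.
apply: poly_fun_sum => j; apply: poly_funM; first exact: poly_fun_coef.
by apply: poly_fun_sum => k; apply: poly_funZ; exact: poly_fun_inv.
Qed.

(** In [r], written as its constant term plus the sum of the X_i [deriv i r], each X_i is replaced
    by the element [a i] - 1 of the group ring. *)
Lemma magnus_dense (N : nat) (r : series K I) : exists l : seq (K * F),
  forall w, (size w <= N)%N -> r w = \sum_(p <- l) p.1 * M p.2 w.
Proof.
elim: N r => [|N IH] r.
  exists [:: (r [::], 1%g)] => -[|//] _.
  by rewrite big_seq1 (magnus_nil ha hM) mulr1.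
have [l lE] := choice (fun i => IH (deriv i r)).
exists ((r [::], 1%g) :: flatten [seq [seq (p.1, (a i * p.2)%g) | p <- l i] ++
  [seq (- p.1, p.2) | p <- l i] | i <- enum I]) => w sw.
rewrite big_cons big_flatten big_map /= (magnus1 hM).
under eq_bigr do rewrite big_cat /= !big_map -big_split /=.
case: w sw => [|j w] sw.
  rewrite big1_seq ?addr0 ?mulr1// => i _; apply: big1 => p _ /=.
  by rewrite (magnus_aM_nil hM) mulNr subrr.
rewrite mulr0 add0r big_enum /= (bigD1 j)//= [X in _ + X]big1 ?addr0.
  rewrite -[LHS]/(deriv j r w) lE//. apply: eq_bigr => p _.
  by rewrite (magnus_aM_cons hM) eqxx mul1r mulrDr mulNr addrAC subrr add0r.
move=> i /negPf ij; apply: big1 => p _.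
by rewrite (magnus_aM_cons hM) eq_sym ij mul0r addr0 mulNr subrr.
Qed.

(* [poly_fun]s that are invariant under right translation by v are invariant
   under right translation by u, since r is a limit of elements of K[F]. *)
Lemma commute_of_left_multiple (u v : F) (r : series K I) :
  M u - 1 = r * (M v - 1) -> commute u v.
Proof.
move=> ur; suff : (u * v * u^-1 = v)%g by move=> /(canRL (mulgVK _)).
apply: (magnus_inj ha hM); apply/funext => t.
have [l lE] := poly_fun_conj v t.
have {}lE h : M (h * v * h^-1)%g t = \sum_(p <- l) p.1 * M h p.2 := lE h.
have v1 : v = (1 * v * 1^-1)%g by rewrite mul1g invg1 mulg1.
rewrite [in RHS]v1 !lE {v1}.
(* The function psi sending [h] to [M (h * v * h^-1) t] involves only the words in [l], so [r]
   matters only up to their maximal length, where it agrees with the group ring element [l']. *)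
have [l' l'E] := magnus_dense (\max_(p <- l) size p.2) r.
apply/eqP; rewrite -subr_eq0 -sumrB; apply/eqP.
transitivity (\sum_(p <- l) \sum_(q <- l') q.1 * (p.1 * (M (q.2 * v)%g p.2 - M q.2 p.2))).
  rewrite big_seq [RHS]big_seq; apply: eq_bigr => p pl.
  rewrite -mulrBr -(magnus1 hM) in ur *.
  have := congr1 (@^~ p.2) ur; rewrite seriesDE seriesNE => ->.
  under eq_bigr do rewrite mulrCA.
  rewrite -mulr_sumr; congr (_ * _); rewrite seriesME.
  transitivity (\sum_(j < (size p.2).+1) \sum_(q <- l')
      q.1 * (M q.2 (take j p.2) * (M v - M 1%g) (drop j p.2))).
    apply: eq_bigr => j _; rewrite l'E ?mulr_suml.
      by apply: eq_bigr => q _; rewrite mulrA.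
    by rewrite (leq_trans _ (leq_bigmax_seq _ pl _)) // size_take; case: ltnP => // /ltnW.
  rewrite exchange_big /=; apply: eq_bigr => q _; rewrite -mulr_sumr -seriesME.
  by rewrite (magnus1 hM) mulrBr mulr1 -(magnusM hM).
(* Thus psi(u) - psi(1) is a combination of differences psi(q v) - psi(q), each of which is 0. *)
rewrite exchange_big big1// => q _; rewrite -mulr_sumr.
under eq_bigr do rewrite mulrBr; rewrite sumrB -!lE.
by rewrite invgM !mulgA mulgK subrr mulr0.
Qed.

End Centralizer.

(** * Forests in Cayley graphs *)

Section CycleSpace.
Variables (K : fieldType) (E T : choiceType) (src tgt : E -> T).

(** The columns of the incidence matrix sum to 0, so its rank is less than the number of vertices;
    with at least as many edges, its rows are dependent, and a dependency is a cycle. *)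
Lemma cycle_exists (Q : {fset E}) (V : {fset T}) :
  (forall e, e \in Q -> (src e \in V) && (tgt e \in V)) ->
  (0 < #|` V| <= #|` Q|)%N ->
  exists2 lam : E -> K, (exists2 e, e \in Q & lam e != 0) &
    forall phi : T -> K, \sum_(e <- Q) lam e * (phi (tgt e) - phi (src e)) = 0.
Proof.
move=> QV /andP[V0 VQ].
pose N : 'M[K]_(#|{: Q}|, #|{: V}|) := \matrix_(i, j)
  ((tgt (val (enum_val i)) == val (enum_val j))%:R -
   (src (val (enum_val i)) == val (enum_val j))%:R).
have sumV x : x \in V -> forall phi : T -> K,
    \sum_(j < #|{: V}|) (x == val (enum_val j))%:R * phi (val (enum_val j)) = phi x.
  move=> xV phi; rewrite (bigD1 (enum_rank [` xV]%fset)) //= enum_rankK /= eqxx mul1r.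
  rewrite big1 ?addr0// => j; apply: contraNeq => /eqP H; apply/eqP.
  have [e|e] := eqVneq x (val (enum_val j)); last by rewrite (negPf e) mul0r in H.
  by apply: enum_val_inj; rewrite enum_rankK; apply/val_inj.
have sumN i phi : \sum_j N i j * phi (val (enum_val j)) =
    phi (tgt (val (enum_val i))) - phi (src (val (enum_val i))).
  have /andP[sV tV] := QV _ (valP (enum_val i)).
  by under eq_bigr do rewrite mxE mulrBl; rewrite sumrB !sumV.
have rkN : (\rank N < #|{: Q}|)%N.
  apply: (@leq_trans #|` V|); last by rewrite -cardfE.
  rewrite cardfE ltn_neqAle rank_leq_col andbT.
  apply/negP => /row_fullP[B BN].
  have : N *m (const_mx 1 : 'cV_#|{: V}|) = 0.
    apply/matrixP => i j; rewrite !mxE -[RHS](subrr 1) -(sumN i (fun=> 1)).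
    by apply: eq_bigr => k _; rewrite [X in _ * X]mxE.
  move=> /(congr1 (mulmx B)); rewrite mulmxA BN mul1mx mulmx0 => /matrixP.
  move: V0; rewrite cardfE => V0 /(_ (Ordinal V0) 0) /eqP.
  by rewrite !mxE oner_eq0.
have /rowV0Pn[lam /sub_kermxP lamN lam0] : kermx N != 0.
  by rewrite -mxrank_eq0 mxrank_ker subn_eq0 -ltnNge.
exists (fun e => if insub e is Some q then lam 0 (enum_rank (q : Q)) else 0).
  have [i li] : exists i, lam 0 i != 0.
    apply/existsP; apply: contraNT lam0 => /existsPn H.
    by apply/eqP/rowP => j; rewrite mxE; apply/eqP/negPn.
  by exists (val (enum_val i)); rewrite ?(valP (enum_val i)) // valK enum_valK.
move=> phi; rewrite big_seq_fsetE /=.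
under eq_bigr do rewrite valK.
rewrite (reindex _ (onW_bij _ (@enum_val_bij {: Q}))) /=.
under eq_bigr do rewrite enum_valK -sumN mulr_sumr.
rewrite exchange_big big1// => j _; under eq_bigr do rewrite mulrA.
rewrite -mulr_suml; have /rowP/(_ j) := lamN; rewrite !mxE => ->.
by rewrite mul0r.
Qed.

End CycleSpace.

Section Acyclic.
Variable F : groupType.

(* Acyclicity of the Cayley graph with edges (g, u) from g to g u, u in W, stated
   by counting: a finite forest has fewer edges than vertices. *)
Definition cayley_forest (W : {fset F}) :=
  forall (Q : {fset F * F}) (V : {fset F}), (0 < #|` V|)%N ->
  (forall e, e \in Q -> [/\ e.2 \in W, e.1 \in V & (e.1 * e.2)%g \in V]) ->
  (#|` Q| < #|` V|)%N.

Variables (K : numFieldType) (I : finType) (a : I -> F) (M : F -> series K I).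
Hypotheses (ha : free_basis a) (hM : magnus_hom a M).

(** A cycle [lam], grouped by labels, gives a relation whose coefficient at [u] is the sum of
    [lam e] times the Magnus image of the start of [e], over edges labelled [u]. *)
Lemma cayley_forest_of_left_free (W : {fset F}) :
  (forall f : F -> series K I, \sum_(u <- W) f u * (M u - 1) = 0 ->
     forall u, u \in W -> f u = 0) ->
  cayley_forest W.
Proof.
move=> Wfree Q V V0 QV; rewrite ltnNge; apply/negP => VQ.
have [||lam [e0 e0Q le0] cyc] :=
  @cycle_exists K _ _ fst (fun e : F * F => (e.1 * e.2)%g) Q V.
- by move=> e /QV[_ -> ->].
- by rewrite V0.
pose f u : series K I := fun w => \sum_(e <- Q | e.2 == u) lam e * M e.1 w.
have fW : \sum_(u <- W) f u * (M u - 1) = 0.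
  have -> : \sum_(u <- W) f u * (M u - 1) =
      \sum_(e <- Q) scale_series (lam e) (M (e.1 * e.2)%g - M e.1).
    transitivity (\sum_(u <- W) \sum_(e <- Q | e.2 == u)
        scale_series (lam e) (M (e.1 * e.2)%g - M e.1)).
      apply: eq_bigr => u _.
      have -> : f u = \sum_(e <- Q | e.2 == u) scale_series (lam e) (M e.1).
        by apply/funext => w; rewrite series_sumE.
      rewrite mulr_suml; apply: eq_bigr => e /eqP eu.
      by rewrite scale_seriesMl mulrBr mulr1 (magnusM hM) eu.
    rewrite (exchange_big_dep xpredT) //= big_seq [RHS]big_seq.
    apply: eq_bigr => e /QV[eW _ _].
    rewrite (big_rem e.2) //= eqxx big_seq_cond big1 ?addr0//.
    by move=> u /andP[]; rewrite mem_rem_uniq ?fset_uniq// inE eq_sym => /andP[/negPf->].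
  apply/funext => w; rewrite series_sumE; exact: (cyc (fun v => M v w)).
have [e0W _ _] := QV _ e0Q.
have := Wfree _ fW _ e0W => /(congr1 (fun s : series K I => s)) fe0.
pose r := [seq e.1 | e <- Q & e.2 == e0.2].
have ur : uniq r.
  rewrite map_inj_in_uniq ?filter_uniq ?fset_uniq//.
  move=> [x1 x2] [y1 y2]; rewrite !mem_filter /= => /andP[/eqP -> _] /andP[/eqP -> _].
  by move=> ->.
have /negP[] := le0; apply/eqP.
have -> : e0 = (e0.1, e0.2) by case: (e0).
(* Edges with a common label have distinct starts, so linear independence of the Magnus images makes
   [lam] vanish on them. *)
apply: (magnus_free ha hM (c := fun g => lam (g, e0.2)) ur).
  move=> w; rewrite big_map big_filter -[RHS](congr1 (@^~ w) fe0) /f.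
  by apply: eq_bigr => -[x1 x2] /= /eqP ->.
by apply/mapP; exists e0; rewrite // mem_filter eqxx.
Qed.

End Acyclic.

Theorem three_forests (d : nat) (hd : (1 < d)%N)
    (F : groupType) (a : 'I_d -> F) (ha : free_basis a)
    (U : {fset F}) (hgen : generates U) (hcard : #|` U|%fset = d.+1)
    (hU : commuting_pair_free U) :
  exists T : {fset F}, [/\ (T `<=` U)%fset, #|` T|%fset = 3%N &
    forall x, x \in T -> cayley_forest (U `\ x)%fset].
Proof.
have [M hM] := magnus_hom_exists rat ha.
pose u (j : 'I_d.+1) := nth 1%g U j.
have uU j : u j \in U by apply: mem_nth; rewrite hcard.
have u_inj : injective u.
  move=> i j /eqP; rewrite nth_uniq ?fset_uniq ?hcard// => /eqP; exact: val_inj.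
have u_surj x : x \in U -> exists j, x = u j.
  move=> xU; have xd : (index x U < d.+1)%N by rewrite -hcard index_mem.
  by exists (Ordinal xd); rewrite /u /= nth_index.
pose c j := M (u j) - 1.
have c0 j : c j [::] = 0 by rewrite /c seriesDE seriesNE (magnus_nil ha hM) subrr.
(* The linear part is additive on the group. Since [U] generates, the rows of [A] span the linear
   parts of the basis, which are the unit vectors. *)
pose L g : 'rV[rat]_d := \row_i M g [:: i].
have LM g h : L (g * h)%g = L g + L h.
  apply/rowP => i; rewrite !mxE (magnusM hM) seriesM_cons seriesM_nil /deriv.
  by rewrite !(magnus_nil ha hM) mul1r mulr1 addrC.
have L1 : L 1%g = 0 by apply/rowP => i; rewrite !mxE (magnus1 hM).
have LV g : L g^-1%g = - L g by apply/eqP; rewrite -addr_eq0 -LM mulVg L1.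
pose A : 'M[rat]_(d.+1, d) := \matrix_(j, i) c j [:: i].
have rowA j : row j A = L (u j).
  by apply/rowP => i; rewrite !mxE /c seriesDE seriesNE subr0.
have LA g : (L g <= A)%MS.
  have [n [w [_ wU ->]]] := hgen g.
  elim: w wU => [|s w IH] wU; first by rewrite big_nil L1 sub0mx.
  rewrite big_cons LM addmx_sub ?IH//; last by move=> t tw; apply: wU; rewrite inE tw orbT.
  have [/u_surj[j ->]|/u_surj[j sj]] := orP (wU s (mem_head _ _)).
    by rewrite -rowA row_sub.
  by rewrite -[s]invgK LV sj -rowA -scaleN1r scalemx_sub ?row_sub.
have A_full : row_full A.
  rewrite -sub1mx; apply/row_subP => i.
  have -> : row i 1%:M = L (a i); last exact: LA.
  apply/rowP => k; case: hM => _ _ Ma; rewrite !mxE Ma seriesDE add0r.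
  by rewrite /seriesX eqseq_cons andbT eq_sym.
have [rho [[j0 rho1] rhoc] rhoP] := relation_module_cyclic c0 A_full.
have forest i : rho i <> 0 -> cayley_forest (U `\ u i)%fset.
  move=> ri; apply: (cayley_forest_of_left_free ha hM) => f fU.
  (* A relation without [u i] is extended by 0 at [i]. It equals [s * rho], and its entry at [i]
     gives [s = 0]. *)
  pose f' j := if j == i then 0 else f (u j).
  have [s sE] : exists s, forall j, f' j = s * rho j.
    apply: rhoP; rewrite -[RHS]fU (bigD1 i) //= {1}/f' eqxx mul0r add0r.
    have Uperm : perm_eq (U `\ u i)%fset [seq u j | j <- enum 'I_d.+1 & j != i].
      apply: uniq_perm; rewrite ?fset_uniq ?map_inj_uniq 1?filter_uniq ?enum_uniq//.
      move=> x; rewrite in_fsetD1; apply/andP/mapP => [[xi /u_surj[j xj]]|[j]].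
        by exists j; rewrite // mem_filter mem_enum andbT; apply: contraNneq xi => <-; rewrite xj.
      by rewrite mem_filter => /andP[ji _] ->; split=> //; rewrite (inj_eq u_inj).
    rewrite (perm_big _ Uperm) big_map big_filter big_enum_cond /=.
    by apply: eq_bigr => j /negPf ji; rewrite /f' ji.
  have s0 : s = 0.
    apply: contrapT => s0; apply: ri; apply: series_mul_eq0 s0 _.
    by rewrite -sE /f' eqxx.
  move=> x /fsetD1P[xi /u_surj[j xj]]; have := sE j.
  by rewrite s0 mul0r /f' xj (_ : j == i = false) // -(inj_eq u_inj) -xj; apply/negbTE.
(* Two nonzero entries besides [rho j0 = 1] give the three labels. Otherwise the relation involves
   at most [j0] and one index [j1], which is arbitrary if [S] is empty. *)
pose S := [set j | (rho j != 0) && (j != j0)].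
have [/card_gt1P[j1 [j2 [j1S j2S j12]]]|S1] := ltnP 1 #|S|.
  move: j1S j2S; rewrite !inE => /andP[r1 j10] /andP[r2 j20].
  exists [fset u j0; u j1; u j2]%fset; split.
  - by apply/fsubsetP => x; rewrite !inE => /orP[/orP[]|] /eqP ->.
  - rewrite fsetUC cardfsU1 cardfs2 !inE !(inj_eq u_inj).
    by rewrite negb_or j20 (eq_sym j2) j12 (eq_sym j0) j10.
  - have r0 : rho j0 != 0 by rewrite rho1 oner_neq0.
    by move=> x; rewrite !inE => /orP[/orP[]|] /eqP ->; apply: forest; apply/eqP.
have [j1 j10 rj1] : exists2 j1, j1 != j0 & forall j, j != j0 -> j != j1 -> rho j = 0.
  have [S0|[j1 j1S]] := set_0Vmem S.
    have d1 : (0 < d)%N by exact: ltnW.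
    exists (lift j0 (Ordinal d1)); first by rewrite eq_sym neq_lift.
    move=> j jj0 _; apply/eqP/negPn; have : j \notin S by rewrite S0 inE.
    by rewrite inE jj0 andbT.
  exists j1; first by move: j1S; rewrite inE => /andP[].
  move=> j jj0 jj1; apply/eqP/negPn/negP => rj; move/eqP: jj1; apply.
  by move/card_le1_eqP: S1; apply => //; rewrite inE rj.
have := hU (u j0) (u j1) (uU _) (uU _); case; first by rewrite (inj_eq u_inj) eq_sym.
apply: (commute_of_left_multiple ha hM (r := - rho j1)).
move/eqP: rhoc; rewrite (bigD1 j0) //= (bigD1 j1) //= big1 ?addr0.
  by rewrite rho1 mul1r addr_eq0 mulNr => /eqP.
by move=> j /andP[jj0 jj1]; rewrite rj1 ?mul0r.
Qed.

(** * Neighbourhoods of finite sets *)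

Lemma leq_count_inj (T : eqType) (f : T -> T) (P1 P2 : pred T) (s1 s2 : seq T) :
  uniq s1 -> injective f -> (forall x, x \in s1 -> P1 x -> (f x \in s2) && P2 (f x)) ->
  (count P1 s1 <= count P2 s2)%N.
Proof.
move=> us1 f_inj s12; rewrite -!size_filter -(size_map f); apply: uniq_leq_size.
  by rewrite map_inj_uniq ?filter_uniq.
move=> y /mapP[x]; rewrite mem_filter => /andP[px xs1] ->.
by rewrite mem_filter andbC s12.
Qed.

(* Here bx, by_, bz, bf say whether a point outside B is joined to B by an edge
   labelled x, y, z or by one of the other m edges; the left-hand side counts the
   three forests that see it. *)
Fact touching_arith (bx by_ bz bf : bool) (m : nat) :
  (bf <= m)%N -> [|| bx, by_, bz | bf] ->
  ([|| by_, bz | bf] + [|| bx, bz | bf] + [|| bx, by_ | bf]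
     <= 1 + bx + by_ + bz + 2 * m)%N.
Proof. by case: bx by_ bz bf => [] [] [] [] //=; lia. Qed.

(** Here [s] counts the labels other than x, y, z, and [i], [t] sum their inner and outer edges;
    [hx] counts the [o] outside points seen by the forest without x. The three forest inequalities
    are added. *)
Fact forest_count_arith (N s ox oy oz i t hx hy hz o : nat) :
  (i + t = s * N)%N ->
  (N + oy + (N + oz + (s * N + t)) < N + hx)%N ->
  (N + ox + (N + oz + (s * N + t)) < N + hy)%N ->
  (N + ox + (N + oy + (s * N + t)) < N + hz)%N ->
  (hx + hy + hz <= o + 2 * ox + 2 * oy + 2 * oz + 4 * t)%N ->
  ((2 * s.+3 - 2) * N + i <= N + o)%N.
Proof.
have -> : (2 * s.+3 - 2 = 2 * s + 4)%N by lia.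
by rewrite mulnDl -mulnA => <-; lia.
Qed.

Section Neighborhood.
Variable F : groupType.
Implicit Types (U W B : {fset F}) (u w g : F).

Definition neighborhood W B : {fset F} :=
  (B `|` [fset (g * u)%g | g in B, u in W] `|` [fset (g * u^-1)%g | g in B, u in W])%fset.

Definition touches B u w := ((w * u^-1)%g \in B) || ((w * u)%g \in B).

Lemma in_neighborhood W B w :
  (w \in neighborhood W B) = (w \in B) || has (fun u => touches B u w) W.
Proof.
rewrite !in_fsetU -orbA; congr (_ || _); apply/idP/hasP.
  case/orP=> /imfset2P[g /= gB [u /= uW ->]]; exists u => //.
    by rewrite /touches mulgK gB.
  by rewrite /touches mulgVK gB orbT.
move=> [u uW /orP[wB|wB]]; apply/orP; [left|right]; apply/imfset2P.
  by exists (w * u^-1)%g => //; exists u; rewrite ?mulgVK.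
by exists (w * u)%g => //; exists u; rewrite ?mulgK.
Qed.

Definition inner B u := count (fun g => (g * u)%g \in B) B.
Definition outer B u := count (fun g => (g * u)%g \notin B) B.

Lemma inner_outer B u : (inner B u + outer B u)%N = #|` B|.
Proof. exact: count_predC. Qed.

Lemma innerV B u : inner B u^-1%g = inner B u.
Proof.
apply/eqP; rewrite eqn_leq; apply/andP; split.
  apply: (@leq_count_inj _ (fun g => g * u^-1)%g); rewrite ?fset_uniq//; first exact: mulIg.
  by move=> x xB xuB; rewrite mulgVK xB xuB.
apply: (@leq_count_inj _ (fun g => g * u)%g); rewrite ?fset_uniq//; first exact: mulIg.
by move=> x xB xuB; rewrite mulgK xB xuB.
Qed.

(** The edges labelled [u] that leave [B] and those that enter it both number |B| minus the inner
    ones. *)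
Lemma outerV B u : outer B u^-1%g = outer B u.
Proof. by apply: (@addnI (inner B u)); rewrite -{1}innerV !inner_outer. Qed.

Lemma count_touches B (O : {fset F}) u : [disjoint O & B]%fset ->
  (\sum_(w <- O) (touches B u w) <= 2 * outer B u)%N.
Proof.
move=> OB; have notB w : w \in O -> w \notin B by move/fdisjointP: OB; apply.
rewrite mul2n -addnn.
apply: (@leq_trans (\sum_(w <- O) (((w * u^-1)%g \in B) + ((w * u)%g \in B)))).
  by apply: leq_sum => w _; rewrite /touches; case: (_ \in B) => //; case: (_ \in B).
rewrite big_split /=.
have cnt (v : F) : (\sum_(w <- O) ((w * v)%g \in B) <= outer B v^-1%g)%N.
  rewrite -big_mkcond /= sum1_count.
  apply: (@leq_count_inj _ (fun g => g * v)%g); rewrite ?fset_uniq//; first exact: mulIg.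
  by move=> x xO xB; rewrite xB mulgK notB.
apply: leq_add; last by rewrite -outerV cnt.
by rewrite -[X in (_ <= outer _ X)%N]invgK cnt.
Qed.

(** The starts of all edges labelled [u] with an end in [B]: first those starting in [B], then those
    entering it. *)
Definition edge_starts B u := B ++ [seq (g * u^-1)%g | g <- B & (g * u^-1)%g \notin B].

Lemma edge_starts_uniq B u : uniq (edge_starts B u).
Proof.
rewrite cat_uniq fset_uniq map_inj_uniq ?filter_uniq ?fset_uniq ?andbT//; last exact: mulIg.
apply/hasPn => v /mapP[g]; rewrite mem_filter => /andP[gB _] vE.
by rewrite vE.
Qed.

Lemma size_edge_starts B u : size (edge_starts B u) = (#|` B| + outer B u)%N.
Proof. by rewrite size_cat size_map size_filter -/(outer B u^-1%g) outerV. Qed.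

Lemma edge_starts_neighborhood W B u g : u \in W -> g \in edge_starts B u ->
  (g \in neighborhood W B) && ((g * u)%g \in neighborhood W B).
Proof.
move=> uW; rewrite !in_neighborhood mem_cat => /orP[gB|/mapP[h]].
  rewrite gB; apply/orP; right; apply/hasP; exists u => //.
  by rewrite /touches mulgK gB.
rewrite mem_filter => /andP[_ hB ->]; rewrite mulgVK hB andbT.
by apply/orP; right; apply/hasP; exists u; rewrite // /touches mulgVK hB orbT.
Qed.

(** All edges with a label in [W] and an end in [B] lie in the neighbourhood, and a finite forest
    has fewer edges than vertices. *)
Lemma forest_neighborhood W B : cayley_forest W -> B != fset0 ->
  (\sum_(u <- W) (#|` B| + outer B u) < #|` neighborhood W B|)%N.
Proof.
move=> forestW B0.
pose s := [seq (g, u) | u <- W, g <- edge_starts B u].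
have us : uniq s.
  apply: allpairs_uniq_dep => [|u uW|[u g] [v h] _ _ [-> ->]//].
    exact: fset_uniq.
  exact: edge_starts_uniq.
have <- : #|` [fset e in s]%fset| = (\sum_(u <- W) (#|` B| + outer B u))%N.
  rewrite card_fseq undup_id // size_allpairs_dep sumnE big_map.
  by apply: eq_bigr => u _; exact: size_edge_starts.
apply: forestW.
  rewrite cardfs_gt0; apply: contraNneq B0 => V0; rewrite -fsubset0 -V0.
  by apply/fsubsetP => x xB; rewrite in_neighborhood xB.
move=> e es; have /allpairsPdep[u [g [uW gA ->]]] : e \in s by rewrite inE in es.
by have /andP[gV guV] := edge_starts_neighborhood uW gA; split.
Qed.

Lemma inner_neighborhood U B u : u \in U ->
  (#|` B| + outer B u <= inner (neighborhood U B) u)%N.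
Proof.
move=> uU; rewrite -size_edge_starts /inner -size_filter; apply: uniq_leq_size.
  exact: edge_starts_uniq.
by move=> g /(edge_starts_neighborhood uU)/andP[gV guV]; rewrite mem_filter guV.
Qed.

Lemma neighborhood_growth U B (x y z : F) : B != fset0 ->
  x \in U -> y \in U -> z \in U -> x != y -> x != z -> y != z ->
  (forall t, t \in [:: x; y; z] -> cayley_forest (U `\ t)%fset) ->
  ((2 * #|` U| - 2) * #|` B| + \sum_(u <- (U `\` [fset x; y; z])%fset) inner B u
     <= #|` neighborhood U B|)%N.
Proof.
move=> B0 xU yU zU xy xz yz forestU.
set N := #|` B|; set Uf := (U `\` [fset x; y; z])%fset.
set O := (neighborhood U B `\` B)%fset.
have OB : [disjoint O & B]%fset.
  by apply/fdisjointP => w; rewrite in_fsetD => /andP[].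
have NO : #|` neighborhood U B| = (N + #|` O|)%N.
  rewrite -cardfsUI (_ : (B `&` O)%fset = fset0) ?cardfs0 ?addn0.
    congr #|` _|; apply/fsetP => w; rewrite in_fsetU in_fsetD in_neighborhood.
    by case: (w \in B).
  by apply/eqP; rewrite -/(fdisjoint _ _) fdisjoint_sym.
have permU : perm_eq U [:: x, y, z & Uf].
  apply: uniq_perm; first exact: fset_uniq.
    by rewrite /= !inE !negb_or xy xz yz !eqxx fset_uniq /= !andbF.
  move=> w; rewrite !inE; case: eqVneq => [->//|wx]; case: eqVneq => [->//|wy].
  by case: eqVneq => [->|].
have permD t s : perm_eq U (t :: s) -> perm_eq (U `\ t)%fset s.
  move=> Us; rewrite -(perm_cons t); apply: (perm_trans _ Us).
  have tU : t \in U by rewrite (perm_mem Us) mem_head.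
  rewrite perm_sym; apply: uniq_perm; rewrite ?fset_uniq//=.
    by rewrite !inE eqxx fset_uniq.
  by move=> w; rewrite !inE; case: eqVneq => [->|].
have bound t s : t \in [:: x; y; z] -> perm_eq U (t :: s) ->
    (\sum_(u <- s) (N + outer B u) < N + \sum_(w <- O) has (touches B ^~ w) s)%N.
  move=> txyz Us; have permt := permD _ _ Us.
  rewrite -(perm_big _ permt); apply: (leq_trans (forest_neighborhood (forestU _ txyz) B0)).
  rewrite -big_mkcond /= sum1_count -size_filter -size_cat.
  apply: uniq_leq_size; first exact: fset_uniq.
  move=> w; rewrite in_neighborhood mem_cat mem_filter in_fsetD in_neighborhood.
  case: (w \in B) => //= hw; rewrite -(perm_has _ permt) hw /=.
  case/hasP: hw => u; rewrite in_fsetD1 => /andP[_ uU] tu.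
  by apply/hasP; exists u.
have permy : perm_eq U [:: y, x, z & Uf].
  by apply: perm_trans permU _; rewrite (perm_catCA [:: x] [:: y] (z :: Uf)).
have permz : perm_eq U [:: z, x, y & Uf].
  by apply: perm_trans permU _; rewrite (perm_catCA [:: x; y] [:: z] Uf).
have := bound x _ (mem_head _ _) permU; have := bound y _ _ permy; have := bound z _ _ permz.
rewrite !inE !eqxx !orbT => /(_ isT) bz /(_ isT) by_ bx.
have hasO w : w \in O -> has (touches B ^~ w) U.
  by rewrite in_fsetD in_neighborhood; case: (w \in B).
(* A point of [O] is seen by at most three forests. Any excess over 1 is charged to its edges to
   [B]: once for each of the labels x, y, z and twice for any other label; [count_touches] doubles
   these weights. *)
have sumO : (\sum_(w <- O) (has (touches B ^~ w) [:: y, z & Uf] +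
    has (touches B ^~ w) [:: x, z & Uf] + has (touches B ^~ w) [:: x, y & Uf])
  <= #|` O| + 2 * outer B x + 2 * outer B y + 2 * outer B z +
     4 * \sum_(u <- Uf) outer B u)%N.
  apply: (@leq_trans (\sum_(w <- O) (1 + touches B x w + touches B y w + touches B z w +
      2 * \sum_(u <- Uf) touches B u w))); last first.
    have e2 : (\sum_(w <- O) 2 * \sum_(u <- Uf) touches B u w =
        2 * \sum_(u <- Uf) \sum_(w <- O) touches B u w)%N.
      by rewrite exchange_big big_distrr.
    have e3 : (4 * \sum_(u <- Uf) outer B u = 2 * \sum_(u <- Uf) 2 * outer B u)%N.
      by rewrite -big_distrr mulnA.
    rewrite 4!big_split /= -card_fset_sum1 e2 e3.
    by rewrite !leq_add ?count_touches//; apply: leq_sum => u _; exact: count_touches.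
  rewrite big_seq [X in (_ <= X)%N]big_seq; apply: leq_sum => w /hasO.
  rewrite (perm_has _ permU) /=.
  have : (has (touches B ^~ w) Uf <= \sum_(u <- Uf) touches B u w)%N.
    by case: hasP => // -[u uUf tu]; rewrite (big_rem u) //= tu leq_addr.
  exact: touching_arith.
rewrite 2!big_split /= in sumO.
have splitN (s : seq F) : (\sum_(u <- s) (N + outer B u) =
    size s * N + \sum_(u <- s) outer B u)%N.
  by rewrite big_split /= big_const_seq count_predT iter_addn_0 mulnC.
have cU : #|` U| = (size Uf).+3 by rewrite (perm_size permU).
have innerUf : (\sum_(u <- Uf) inner B u + \sum_(u <- Uf) outer B u = size Uf * N)%N.
  rewrite -big_split /= (eq_bigr (fun=> N)) => [|u _]; last exact: inner_outer.
  by rewrite big_const_seq count_predT iter_addn_0 mulnC.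
move: bx by_ bz sumO; rewrite !big_cons !splitN NO cU -/N /= => bx by_ bz sumO.
exact: forest_count_arith innerUf bx by_ bz sumO.
Qed.

End Neighborhood.

(** * Balls and the lower bound on their size *)

Section Balls.
Variables (F : groupType) (U : {fset F}).

Definition ball_fset n : {fset F} := iter n (neighborhood U) [fset 1%g]%fset.

Lemma ball_fsetP n x : word_ball U n x <-> x \in ball_fset n.
Proof.
split.
  case=> w [sw wU ->]; elim/last_ind: w n sw wU => [|w s IH] n.
    move=> _ _; rewrite big_nil; elim: n => [|n IH]; first by rewrite inE.
    by rewrite [ball_fset _]iterS in_neighborhood IH.
  case: n => [|n]; rewrite size_rcons // => sw wU.
  rewrite -cats1 big_cat big_seq1 [ball_fset _]iterS in_neighborhood; apply/orP; right.
  have gB : (\prod_(t <- w) t)%g \in ball_fset n.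
    by apply: IH => // t tw; apply: wU; rewrite mem_rcons inE tw orbT.
  have /orP[sU|sU] := wU s (eq_ind_r _ (mem_head _ _) (mem_rcons _ _ _)).
    by apply/hasP; exists s; rewrite // /touches mulgK gB.
  by apply/hasP; exists (s^-1)%g; rewrite // /touches mulgK gB orbT.
elim: n x => [|n IH] x.
  by rewrite inE => /eqP ->; exists [::]; rewrite big_nil.
rewrite [ball_fset _]iterS in_neighborhood => /orP[/IH[w [sw wU ->]]|/hasP[u uU]].
  by exists w; split=> //; exact: ltnW.
case/orP=> /IH[w [sw wU wE]].
  exists (rcons w u); split; first by rewrite size_rcons.
    by move=> s; rewrite mem_rcons inE => /orP[/eqP ->|/wU//]; rewrite uU.
  by rewrite -cats1 big_cat big_seq1 /= -wE mulgVK.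
exists (rcons w u^-1%g); split; first by rewrite size_rcons.
  by move=> s; rewrite mem_rcons inE => /orP[/eqP ->|/wU//]; rewrite invgK uU orbT.
by rewrite -cats1 big_cat big_seq1 /= -wE mulgK.
Qed.

Lemma fset_set_word_ball n : fset_set (word_ball U n) = ball_fset n.
Proof.
rewrite -[RHS]set_fsetK; congr fset_set; apply/seteqP.
by split=> x /ball_fsetP.
Qed.

Lemma ball_fset_neq0 n : ball_fset n != fset0.
Proof.
apply/fset0Pn; exists 1%g; apply/ball_fsetP.
by exists [::]; rewrite big_nil.
Qed.

Lemma card_ball_fset_submul m n :
  (#|` ball_fset (m + n)| <= #|` ball_fset m| * #|` ball_fset n|)%N.
Proof.
rewrite -(size_allpairs (fun g h : F => (g * h)%g)); apply: uniq_leq_size.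
  exact: fset_uniq.
move=> x /ball_fsetP[w [sw wU ->]]; apply/allpairsP.
exists ((\prod_(s <- take m w) s)%g, (\prod_(s <- drop m w) s)%g); split.
- apply/ball_fsetP; exists (take m w); split=> // [|s /mem_take/wU//].
  by rewrite size_take; case: ltnP.
- apply/ball_fsetP; exists (drop m w); split=> // [|s /mem_drop/wU//].
  by rewrite size_drop; lia.
- by rewrite /= -big_cat cat_take_drop.
Qed.

End Balls.

(** The positive root of b^2 = (2d - 1) b + 4 (d - 1). *)
Definition beta (R : realType) (d : nat) : R :=
  (d.*2.-1%:R + Num.sqrt (d.*2.-1%:R ^+ 2 + 16 * d.-1%:R)) / 2.

Lemma beta_eq (R : realType) d : (1 < d)%N ->
  beta R d ^+ 2 = (2 * d%:R - 1) * beta R d + 4 * (d%:R - 1).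
Proof.
move=> d1; rewrite /beta; set e := Num.sqrt _.
have e2 : e ^+ 2 = d.*2.-1%:R ^+ 2 + 16 * d.-1%:R.
  by rewrite sqr_sqrtr// addr_ge0 ?sqr_ge0 ?mulr_ge0.
have dE : d.-1%:R = d%:R - 1 :> R by rewrite -subn1 natrB // ltnW.
have dE2 : d.*2.-1%:R = 2 * d%:R - 1 :> R.
  by rewrite -subn1 natrB -?mul2n ?natrM //; lia.
by rewrite dE dE2 in e2 *; field: e2.
Qed.

Lemma beta_ge (R : realType) d : (1 < d)%N -> 2 * d%:R - 1 <= beta R d.
Proof.
move=> d1.
have dE2 : d.*2.-1%:R = 2 * d%:R - 1 :> R.
  by rewrite -subn1 natrB -?mul2n ?natrM //; lia.
rewrite /beta ler_pdivlMr // -dE2 [_ * 2]mulr_natr mulr2n lerD2l.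
rewrite -[leLHS]ger0_norm // -sqrtr_sqr ler_sqrt.
  by rewrite lerDl mulr_ge0.
by rewrite addr_ge0 ?sqr_ge0 ?mulr_ge0.
Qed.

(** With N the ball size and f the number of inner edges with the d - 2 labels outside [T], the next
    values satisfy N' >= 2d N + f and f' >= 2(d - 2) N - f. The negative entry is harmless, as the
    two are combined with positive weights. *)
Theorem ball_lower_bound (R : realType) (d : nat) (hd : (1 < d)%N)
    (F : groupType) (a : 'I_d -> F) (ha : free_basis a)
    (U : {fset F}) (hgen : generates U) (hcard : #|` U|%fset = d.+1)
    (hU : commuting_pair_free U) n :
  beta R d ^+ n <= d%:R * #|` ball_fset U n|%:R.
Proof.
have [T [TU T3 forestT]] := three_forests hd ha hgen hcard hU.
have [x [y [z [TE xy xz yz]]]] : exists x y z : F,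
    [/\ enum_fset T = [:: x; y; z], x != y, x != z & y != z].
  move: T3 (fset_uniq T); case: (enum_fset T) => [|x [|y [|z [|]]]] // _.
  rewrite /= !inE negb_or => /and3P[/andP[xy xz] yz _].
  by exists x, y, z.
have inT t : (t \in T) = (t \in [:: x; y; z]) by rewrite -TE.
have TfE : T = [fset x; y; z]%fset.
  by apply/fsetP => t; rewrite inT !inE orbA.
have sub t : t \in [:: x; y; z] -> t \in U by rewrite -inT; exact: fsubsetP.
have xU : x \in U by rewrite sub // !inE eqxx.
have yU : y \in U by rewrite sub // !inE eqxx orbT.
have zU : z \in U by rewrite sub // !inE eqxx !orbT.
pose Uf := (U `\` [fset x; y; z])%fset.
pose N k := #|` ball_fset U k|.
pose f k := (\sum_(u <- Uf) inner (ball_fset U k) u)%N.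
have cUf : (size Uf + 3 = d.+1)%N.
  have <- : size T = 3%N by [].
  rewrite -hcard -(cardfsID T U) addnC; congr (_ + _)%N; last by rewrite /Uf TfE.
  by congr #|` _|; apply/esym/fsetIidPr.
have sUf : (d - 2)%N = size Uf by rewrite -[RHS](addnK 3) cUf subSS.
have sumN k : (f k + \sum_(u <- Uf) outer (ball_fset U k) u = size Uf * N k)%N.
  rewrite -big_split /= (eq_bigr (fun=> N k)) => [|u _]; last exact: inner_outer.
  by rewrite big_const_seq count_predT iter_addn_0 mulnC.
have NS k : (2 * d * N k + f k <= N k.+1)%N.
  have := neighborhood_growth (ball_fset_neq0 U k) xU yU zU xy xz yz.
  rewrite hcard (_ : (2 * d.+1 - 2 = 2 * d)%N); last by rewrite mulnS addKn.
  by apply => t; rewrite -inT; exact: forestT.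
have fS k : (2 * (d - 2) * N k <= f k.+1 + f k)%N.
  have : (\sum_(u <- Uf) (N k + outer (ball_fset U k) u) <= f k.+1)%N.
    rewrite /f big_seq [X in (_ <= X)%N]big_seq; apply: leq_sum => u.
    by rewrite in_fsetD => /andP[_ uU]; exact: inner_neighborhood.
  rewrite big_split /= big_const_seq count_predT iter_addn_0 [(N k * _)%N]mulnC.
  rewrite sUf.
  have := sumN k; rewrite -mulnA.
  by move: (size Uf * N k)%N (f k) (f k.+1) (\sum_(u <- Uf) outer _ u)%N; clear; lia.
set b := beta R d; have bE := beta_eq R hd; have bge := beta_ge R hd.
rewrite -/b in bE bge.
have d2 : 2 <= d%:R :> R by rewrite ler_nat.
have dB2 : (d - 2)%:R = d%:R - 2 :> R by rewrite natrB.
have b0 : 0 < 1 + b by lra.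
(* (1 + b, 1) is the left eigenvector for b of the recursion NS, fS. *)
have key k : (1 + b) * b ^+ k <= (1 + b) * (N k)%:R + (f k)%:R.
  elim: k => [|k IH].
    rewrite expr0 (_ : N 0%N = 1%N); last exact: cardfs1.
    by rewrite lerDl.
  have NSR : 2 * d%:R * (N k)%:R + (f k)%:R <= (N k.+1)%:R :> R.
    by rewrite -!natrM -natrD ler_nat.
  have fSR : 2 * (d%:R - 2) * (N k)%:R <= (f k.+1)%:R + (f k)%:R :> R.
    by rewrite -dB2 -!natrM -natrD ler_nat.
  have bk : b * ((1 + b) * b ^+ k) <= b * ((1 + b) * (N k)%:R + (f k)%:R).
    by rewrite ler_pM2l//; lra.
  have NSb : (1 + b) * (2 * d%:R * (N k)%:R + (f k)%:R) <= (1 + b) * (N k.+1)%:R.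
    by rewrite ler_pM2l.
  have -> : (1 + b) * b ^+ k.+1 = b * ((1 + b) * b ^+ k) by rewrite exprS; ring.
  apply: le_trans bk _; apply: le_trans (_ : _ <= (1 + b) * (2 * d%:R * (N k)%:R + (f k)%:R)
    + (2 * (d%:R - 2) * (N k)%:R - (f k)%:R)) _; last by lra.
  rewrite le_eqVlt; apply/orP; left; apply/eqP.
  have -> : b * ((1 + b) * (N k)%:R + (f k)%:R) =
    (b + b ^+ 2) * (N k)%:R + b * (f k)%:R by ring.
  by rewrite bE; ring.
have fN k : (f k)%:R <= (d%:R - 2) * (N k)%:R :> R.
  rewrite -dB2 -natrM ler_nat.
  rewrite sUf.
  by rewrite -sumN leq_addr.
rewrite -(ler_pM2l b0); apply: le_trans (key n) _.
have := fN n; rewrite -/(N n); have : 0 <= (N n)%:R :> R by [].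
move: ((N n)%:R : R) ((f n)%:R : R) => p q p0 qp.
(* Bounding f by (d - 2) N costs the factor d, which disappears under n-th roots. *)
have : (d%:R - 2) * p <= (1 + b) * (d%:R - 1) * p.
  rewrite ler_wpM2r//; nra.
lra.
Qed.

(** * The upper bound for the basis with a product *)

Lemma sum_leq_mul_size (T : eqType) (s : seq T) (E : T -> nat) c :
  (forall p, p \in s -> (E p <= c)%N) -> (\sum_(p <- s) E p <= c * size s)%N.
Proof.
move=> Ec; rewrite -iter_addn_0 -(count_predT s) -big_const_seq.
by rewrite !big_seq; apply: leq_sum => p /Ec.
Qed.

Section ModelUpperBound.
Variables (d : nat) (hd : (1 < d)%N) (F : groupType) (a : 'I_d -> F).

Let i0 : 'I_d := Ordinal (ltnW hd).
Let i1 : 'I_d := Ordinal hd.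
Let x := a i0.
Let y := a i1.
Let z := (x * y)%g.

Definition triangle_letters : seq F := [:: x; x^-1; y; y^-1; z; z^-1]%g.
Definition free_indices := [seq i <- enum 'I_d | (i != i0) && (i != i1)].
Definition free_letters : seq F :=
  [seq a i | i <- free_indices] ++ [seq (a i)^-1%g | i <- free_indices].

Let letters := triangle_letters ++ free_letters.

Lemma mem_letters s :
  (s \in basis_with_product hd a) || (s^-1%g \in basis_with_product hd a) = (s \in letters).
Proof.
have mem_a i : (a i \in letters) && ((a i)^-1%g \in letters).
  rewrite /letters /triangle_letters /free_letters !mem_cat !inE.
  have [->|ni0] := eqVneq i i0; first by rewrite !eqxx ?orbT.
  have [->|ni1] := eqVneq i i1; first by rewrite !eqxx ?orbT.
  have ifr : i \in free_indices by rewrite mem_filter ni0 ni1 mem_enum.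
  by rewrite !(map_f _ ifr) !orbT.
apply/idP/idP.
  have /andP[zl zVl] : (z \in letters) && (z^-1%g \in letters).
    by rewrite !inE !eqxx !orbT.
  case/orP => /fset1UP[|/imfsetP[i /= _]] => [->//|->|/(canRL invgK) ->//|/(canRL invgK) ->].
    by case/andP: (mem_a i).
  by case/andP: (mem_a i).
have Sa i : a i \in basis_with_product hd a.
  by rewrite !inE; apply/orP; right; apply/imfsetP; exists i.
have Sz : z \in basis_with_product hd a by rewrite !inE eqxx.
move: (basis_with_product hd a) Sa Sz => S Sa Sz.
rewrite /letters /triangle_letters /free_letters !mem_cat !inE.
case/orP=> [/or4P[/eqP->|/eqP->|/eqP->|/or3P[/eqP->|/eqP->|/eqP->]]|
  /orP[/mapP[i _ ->]|/mapP[i _ ->]]];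
  by rewrite ?invgK ?Sa ?Sz ?orbT.
Qed.

Definition admissible (s t : F) : bool := ((s * t)%g != 1%g) && ((s * t)%g \notin letters).

Let adm_inv (s : F) : admissible s s^-1%g = false.
Proof. by rewrite /admissible mulgV eqxx. Qed.

Let adm_letter (s t : F) : (s * t)%g \in letters -> admissible s t = false.
Proof. by rewrite /admissible andbC => ->. Qed.

(** Two of the six successors are excluded: the inverse of [s] and the letter that completes a
    triangle with [s], listed in [e1] to [e6]. *)
Lemma count_admissible_triangle s : s \in triangle_letters ->
  (count (admissible s) triangle_letters <= 4)%N.
Proof.
have tri t : t \in triangle_letters -> t \in letters by rewrite mem_cat => ->.
have adm s' t : (s' * t)%g \in triangle_letters -> admissible s' t = false.
  by move=> /tri /adm_letter.
have e1 : admissible x y = false by apply: adm; rewrite /triangle_letters !inE eqxx !orbT.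
have e2 : admissible x^-1%g z = false.
  by apply: adm; rewrite /triangle_letters /z mulKg !inE eqxx !orbT.
have e3 : admissible y z^-1%g = false.
  by apply: adm; rewrite /triangle_letters /z invgM mulVKg !inE eqxx !orbT.
have e4 : admissible y^-1%g x^-1%g = false.
  by apply: adm; rewrite /triangle_letters -invgM !inE eqxx !orbT.
have e5 : admissible z y^-1%g = false.
  by apply: adm; rewrite /triangle_letters /z mulgK !inE eqxx.
have e6 : admissible z^-1%g x = false.
  by apply: adm; rewrite /triangle_letters /z invgM mulgVK !inE eqxx !orbT.
have adm_inv' t : admissible t^-1%g t = false by rewrite -{2}(invgK t) adm_inv.
rewrite /triangle_letters !inE => /or4P[/eqP->|/eqP->|/eqP->|/or3P[/eqP->|/eqP->|/eqP->]] /=;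
  rewrite ?adm_inv ?adm_inv' ?e1 ?e2 ?e3 ?e4 ?e5 ?e6;
  by do 4!case: (admissible _ _).
Qed.

Lemma count_admissible_free s : s \in free_letters ->
  (count (admissible s) free_letters < size free_letters)%N.
Proof.
move=> sf; have s'f : (s^-1)%g \in free_letters.
  move: sf; rewrite !mem_cat => /orP[/mapP[i ifr ->]|/mapP[i ifr ->]].
    by rewrite (map_f (fun i => (a i)^-1%g) ifr) orbT.
  by rewrite invgK (map_f a ifr).
rewrite -(count_predC (admissible s) free_letters) -[ltnLHS]addn0 ltn_add2l -has_count.
by apply/hasP; exists s^-1%g; rewrite //= adm_inv.
Qed.

Lemma size_free_letters : size free_letters = (2 * (d - 2))%N.
Proof.
rewrite size_cat !size_map addnn -mul2n; congr (2 * _)%N.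
rewrite -[d in RHS]card_ord cardE -(count_predC [in [:: i0; i1]] (enum 'I_d)).
have -> : count [in [:: i0; i1]] (enum 'I_d) = 2%N.
  rewrite -size_filter (@perm_size _ _ [:: i0; i1])//.
  apply: uniq_perm => [||i] /=; [by rewrite filter_uniq ?enum_uniq|by []|].
  by rewrite mem_filter mem_enum andbT.
rewrite addKn size_filter; apply: eq_count => i.
by rewrite !inE negb_or.
Qed.

(** Index [n] stands for words of length n + 1, stored as product and last letter and split by the
    kind of that letter. Repetitions are allowed, as only an upper bound is wanted. *)
Fixpoint normal_forms (n : nat) : seq (F * F) * seq (F * F) :=
  if n is n'.+1 then
    let: (t, f) := normal_forms n' in
    ([seq ((p.1 * s)%g, s) | p <- t ++ f, s <- [seq s <- triangle_letters | admissible p.2 s]],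
     [seq ((p.1 * s)%g, s) | p <- t ++ f, s <- [seq s <- free_letters | admissible p.2 s]])
  else ([seq (s, s) | s <- triangle_letters], [seq (s, s) | s <- free_letters]).

Let nT n := (normal_forms n).1.
Let nF n := (normal_forms n).2.

Lemma normal_formsS n :
  normal_forms n.+1 =
    ([seq ((p.1 * s)%g, s) | p <- nT n ++ nF n, s <- [seq s <- triangle_letters | admissible p.2 s]],
     [seq ((p.1 * s)%g, s) | p <- nT n ++ nF n, s <- [seq s <- free_letters | admissible p.2 s]]).
Proof. by rewrite /= /nT /nF; case: (normal_forms n). Qed.

Lemma normal_forms_last n p :
  (p \in nT n -> p.2 \in triangle_letters) /\ (p \in nF n -> p.2 \in free_letters).
Proof.
rewrite /nT /nF; case: n => [|n]; first by split=> /mapP[s ? ->].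
rewrite normal_formsS; split=> /allpairsPdep[q [s [_]]];
  by rewrite mem_filter => /andP[_ ?] ->.
Qed.

Lemma size_normal_forms_triangle n :
  (size (nT n.+1) <= 4 * size (nT n) + 6 * size (nF n))%N.
Proof.
rewrite {1}/nT normal_formsS size_allpairs_dep sumnE big_map big_cat.
apply: leq_add; apply: sum_leq_mul_size => p pn; rewrite size_filter.
  by apply: count_admissible_triangle; apply: (normal_forms_last n p).1.
exact: count_size.
Qed.

Lemma size_normal_forms_free n :
  (size (nF n.+1) + size (nF n) <= 2 * (d - 2) * (size (nT n) + size (nF n)))%N.
Proof.
rewrite {1}/nF normal_formsS size_allpairs_dep sumnE big_map big_cat.
rewrite -addnA mulnDr -size_free_letters; apply: leq_add.
  by apply: sum_leq_mul_size => p _; rewrite size_filter count_size.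
rewrite -[X in (_ + X)%N]sum1_size -big_split; apply: sum_leq_mul_size => p pn.
rewrite /= size_filter addn1; apply: count_admissible_free.
exact: (normal_forms_last n p).2.
Qed.

Lemma normal_forms_sorted s w : all [in letters] (s :: w) -> sorted admissible (s :: w) ->
  ((\prod_(t <- s :: w) t)%g, last s w) \in nT (size w) ++ nF (size w).
Proof.
elim/last_ind: w => [|w t IH].
  move=> /andP[sl _] _; have {}sl : s \in letters := sl.
  rewrite big_seq1 /nT /nF mem_cat.
  by move: sl; rewrite mem_cat => /orP[] sl; rewrite (map_f (fun s => (s, s)) sl) ?orbT.
rewrite -rcons_cons all_rcons => /andP[tl wl]; rewrite /= rcons_path => /andP[ws adm].
have {}IH := IH wl ws; rewrite size_rcons last_rcons.
rewrite -rcons_cons -cats1 big_cat big_seq1 /= /nT /nF normal_formsS mem_cat.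
have {}tl : t \in letters := tl.
move: tl; rewrite mem_cat => /orP[tl|tl]; apply/orP; [left|right];
  by apply/allpairsPdep; exists ((\prod_(t <- s :: w) t)%g, last s w), t; rewrite mem_filter adm tl.
Qed.

(** An inadmissible pair of letters can be deleted or replaced by a single letter, which shortens
    the word. *)
Lemma sorted_word w : all [in letters] w -> exists w',
  [/\ all [in letters] w', sorted admissible w', (size w' <= size w)%N &
      (\prod_(s <- w') s = \prod_(s <- w) s)%g].
Proof.
elim/ltn_ind: {w}(size w) {-2}w (erefl (size w)) => n IH [|s w] sz.
  by move=> _; exists [::].
move=> /= /andP[sl wl]; have [|[|t w'] [wl' ws' szw wE]] := IH (size w) _ w erefl wl.
- by rewrite -sz.
- by exists [:: s]; rewrite /= sl !big_cons -wE.
have [adm|] := boolP (admissible s t).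
  by exists [:: s, t & w']; split; rewrite /= ?sl ?adm // !big_cons -wE big_cons.
move: wl' => /= /andP[tl wl'].
rewrite negb_and !negbK => /orP[/eqP st1|st].
  exists w'; split=> //; [exact: path_sorted ws'|by move: szw => /=; lia|].
  by rewrite big_cons -wE big_cons mulgA st1 mul1g.
have [||w'' [wl'' ws'' szw'' wE'']] := IH (size ((s * t)%g :: w')) _ _ erefl.
- by rewrite -sz /= in szw *; lia.
- by rewrite /= st wl'.
exists w''; split=> //; first by rewrite /= in szw'' szw *; lia.
by rewrite wE'' !big_cons -wE big_cons mulgA.
Qed.

Lemma card_model_ball n : (#|` ball_fset (basis_with_product hd a) n| <=
  1 + \sum_(k < n) (size (nT k) + size (nF k)))%N.
Proof.
pose r := 1%g :: flatten [seq [seq p.1 | p <- nT k ++ nF k] | k <- iota 0 n].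
have -> : (1 + \sum_(k < n) (size (nT k) + size (nF k)) = size r)%N.
  rewrite /= size_flatten /shape -map_comp sumnE big_map.
  rewrite -(big_mkord xpredT (fun k => size (nT k) + size (nF k))%N) /index_iota subn0.
  by rewrite add1n; congr _.+1; apply: eq_bigr => k _; rewrite /= size_map size_cat.
apply: uniq_leq_size; first exact: fset_uniq.
move=> g /ball_fsetP[w [sw wS ->]].
have [|w' [wl' ws' szw' <-]] := @sorted_word w.
  by apply/allP => s /wS; rewrite mem_letters.
case: w' wl' ws' szw' => [|s w'] wl' ws' szw'; first by rewrite big_nil mem_head.
rewrite inE; apply/orP; right; apply/flatten_mapP; exists (size w').
  by rewrite mem_iota /= add0n; exact: leq_trans szw' sw.
by apply/mapP; exists ((\prod_(t <- s :: w') t)%g, last s w'); first exact: normal_forms_sorted.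
Qed.

(** The bounds t' <= 4t + 6f and f' <= 2(d - 2) t + (2(d - 2) - 1) f have the characteristic
    equation b^2 = (2d - 1) b + 4 (d - 1) of the lower bound. *)
Lemma ball_upper_bound (R : realType) : exists C : R, 0 < C /\
  forall n, #|` ball_fset (basis_with_product hd a) n|%:R <= C * beta R d ^+ n.
Proof.
set b := beta R d; have bE := beta_eq R hd; have bge := beta_ge R hd.
rewrite -/b in bE bge; pose D : R := d%:R; rewrite -/D in bE bge.
have D2 : 2 <= D by rewrite ler_nat.
(* (p, 6) is the left eigenvector for b of the matrix that bounds the recursion
   on the numbers of words ending in a triangle letter or in a free letter. *)
pose p := b - 2 * D + 5.
pose w k : R := p * (size (nT k))%:R + 6 * (size (nF k))%:R.
have dB2 : (d - 2)%:R = D - 2 :> R by rewrite natrB.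
have wS k : w k.+1 <= b * w k.
  have := size_normal_forms_triangle k; have := size_normal_forms_free k.
  rewrite -!(ler_nat R) !natrD !natrM !natrD dB2 /w.
  move: (size (nT k))%:R (size (nF k))%:R (size (nT k.+1))%:R (size (nF k.+1))%:R.
  move=> t f t' f' hf ht.
  have hp : p * t' <= p * (4 * t + 6 * f) by rewrite ler_wpM2l// /p; lra.
  have -> : b * (p * t + 6 * f) = p * (4 * t + 6 * f) + 6 * (2 * (D - 2) * (t + f) - f).
    transitivity ((b ^+ 2 - 2 * D * b + 5 * b) * t + 6 * b * f); first by rewrite /p; ring.
    by rewrite bE /p; ring.
  lra.
have w0 k : 0 <= w k by rewrite addr_ge0 ?mulr_ge0//; rewrite /p; lra.
have wb k : w k <= w 0%N * b ^+ k.
  elim: k => [|k IH]; first by rewrite mulr1.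
  apply: le_trans (wS k) _; rewrite exprS mulrCA ler_wpM2l//; lra.
have szw k : (size (nT k) + size (nF k))%:R <= w k.
  rewrite natrD /w; have : 0 <= (size (nT k))%:R :> R by [].
  have : 0 <= (size (nF k))%:R :> R by [].
  move: (size (nT k))%:R (size (nF k))%:R => t f f0 t0; rewrite lerD//; last lra.
  by rewrite ler_peMl// /p; lra.
exists (1 + w 0%N); split; first by have := w0 0%N; lra.
move=> n; apply: (@le_trans _ _ (1 + w 0%N * \sum_(k < n) b ^+ k)).
  apply: (@le_trans _ _ (1 + \sum_(k < n) (size (nT k) + size (nF k)))%:R).
    by rewrite ler_nat card_model_ball.
  rewrite natrD natr_sum lerD2l mulr_sumr; apply: ler_sum => k _.
  exact: le_trans (szw k) (wb k).
(* The geometric sum is absorbed because b >= 2. *)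
elim: n => [|n IH]; first by rewrite big_ord0 mulr0 addr0 mulr1 lerDl.
rewrite big_ord_recr /= mulrDr addrA exprS.
have bn : 1 <= b ^+ n by rewrite exprn_ege1//; lra.
have := w0 0%N; move: (w 0%N) IH => c IH c0.
have : (1 + c) * (2 * b ^+ n) <= (1 + c) * (b * b ^+ n).
  by apply: ler_wpM2l; [lra|apply: ler_wpM2r; lra].
lra.
Qed.

End ModelUpperBound.

(** * Growth rates *)

Import numFieldNormedType.Exports.
Section Fekete.
Local Open Scope classical_set_scope.

Variable R : realType.

Lemma root_cvg1 (c : R) : 0 < c -> c `^ n%:R^-1 @[n --> \oo] --> (1 : R).
Proof.
move=> c0; have -> : (fun n => c `^ n%:R^-1) = (fun n : nat => expR (n%:R^-1 * ln c)).
  by apply/funext => n; rewrite /powR gt_eqF.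
rewrite -[X in _ --> X]expR0; apply: continuous_cvg; first exact: continuous_expR.
rewrite -[X in _ --> X](mul0r (ln c)); apply: cvgMr_tmp.
by rewrite -(cvg_shiftS (fun n : nat => n%:R^-1 : R)); exact: (@cvg_harmonic R).
Qed.

Variable u : nat -> R.
Hypotheses (u1 : forall n, 1 <= u n) (uM : forall m n, u (m + n)%N <= u m * u n).

Let u0 n : 0 <= u n. Proof. exact: le_trans (u1 n). Qed.

Let x n := u n `^ n%:R^-1.

Let x1 n : 1 <= x n.
Proof. by rewrite -[leLHS](powRr0 (u n)) ler_powR. Qed.

Let submulX m q r : u (q * m + r)%N <= u m ^+ q * u r.
Proof.
elim: q => [|q IH]; first by rewrite mul1r.
rewrite mulSn -addnA; apply: le_trans (uM _ _) _.
by rewrite exprS -mulrA ler_wpM2l.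
Qed.

(** Write n = q m + r with r < m. Then u(n) is at most u(m)^q times a constant depending on m only,
    and q / n <= 1 / m. *)
Let root_bound m n : (0 < m)%N -> (0 < n)%N ->
  x n <= x m * (u 1%N ^+ m * u 0%N) `^ n%:R^-1.
Proof.
move=> m0 n0; have nE := divn_eq n m.
have ur : u (n %% m)%N <= u 1%N ^+ m * u 0%N.
  have := submulX 1 (n %% m) 0; rewrite muln1 addn0 => /le_trans; apply.
  by rewrite ler_wpM2r// ler_weXn2l// ltnW// ltn_mod.
have un : u n <= u m ^+ (n %/ m) * (u 1%N ^+ m * u 0%N).
  rewrite {1}nE; apply: le_trans (submulX _ _ _) _.
  by rewrite ler_wpM2l// exprn_ge0.
have ninv : 0 <= n%:R^-1 :> R by rewrite invr_ge0.
apply: (@le_trans _ _ ((u m ^+ (n %/ m) * (u 1%N ^+ m * u 0%N)) `^ n%:R^-1)).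
  by apply: ge0_ler_powR; rewrite ?nnegrE ?mulr_ge0 ?exprn_ge0.
rewrite powRM ?mulr_ge0 ?exprn_ge0// ler_wpM2r ?powR_ge0//.
rewrite -powR_mulrn// -powRrM ler_powR//.
rewrite ler_pdivrMr ?ltr0n// mulrC ler_pdivlMr ?ltr0n//.
by rewrite -natrM ler_nat leq_trunc_div.
Qed.

Lemma fekete_cvg : cvgn (fun n => u n `^ n%:R^-1).
Proof.
(* The limit is the infimum of the roots over positive indices; the shift leaves out the junk value
   at 0. *)
pose E := [set x n.+1 | n in [set: nat]].
have E_lb : has_lbound E by exists 1 => _ [n _ <-].
have E_inf : has_inf E by split=> //; exists (x 1%N); exists 0%N.
apply/cvg_ex; exists (inf E); apply/cvgrPdist_le => e e0.
have e2 : 0 < e / 2 by rewrite divr_gt0.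
have [_ [m _ <-] xm] := inf_adherent e2 E_inf.
have c0 : 0 < u 1%N ^+ m.+1 * u 0%N.
  by rewrite mulr_gt0 ?exprn_gt0//; exact: lt_le_trans (u1 _).
have lim_xm : x m.+1 * (u 1%N ^+ m.+1 * u 0%N) `^ n%:R^-1 @[n --> \oo] --> x m.+1.
  by rewrite -[X in _ --> X]mulr1; apply: cvgMl_tmp; exact: root_cvg1.
near=> n.
have n0 : (0 < n)%N by near: n; exact: nbhs_infty_gt.
have xE : inf E <= x n.
  by apply: ge_inf => //; exists n.-1 => //; rewrite prednK.
rewrite ler_distlC; apply/andP; split; first by apply: (le_trans _ xE); rewrite gerBl ltW.
apply: le_trans (root_bound (ltn0Sn m) n0) _; apply: ltW.
near: n.
by apply: (cvgr_lt _ lim_xm); lra.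
Unshelve. all: by end_near.
Qed.

End Fekete.

Section GrowthRate.
Local Open Scope classical_set_scope.

Lemma growth_rate_cvg (R : realType) (F : groupType) (U : {fset F}) :
  cvgn (fun n => (#|` ball_fset U n|%fset%:R : R) `^ n%:R^-1).
Proof.
apply: fekete_cvg => [n|m n].
  by rewrite ler1n cardfs_gt0 ball_fset_neq0.
by rewrite -natrM ler_nat card_ball_fset_submul.
Qed.

Lemma growth_rateE (R : realType) (F : groupType) (U : {fset F}) :
  growth_rate R U = limn (fun n => (#|` ball_fset U n|%fset%:R : R) `^ n%:R^-1).
Proof. by rewrite /growth_rate; under eq_fun do rewrite fset_set_word_ball. Qed.

Lemma root_expr (R : realType) (b : R) n : 0 <= b -> (0 < n)%N ->
  (b ^+ n) `^ n%:R^-1 = b.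
Proof.
by move=> b0 n0; rewrite -powR_mulrn// -powRrM mulfV ?powRr1// pnatr_eq0 -lt0n.
Qed.

Lemma beta_ge0 (R : realType) d : (1 < d)%N -> 0 <= beta R d.
Proof.
move=> hd; have d1 : 1 <= d%:R :> R by rewrite ler1n ltnW.
by apply: le_trans (beta_ge R hd); lra.
Qed.

Lemma growth_rate_basis_with_product_le (R : realType) (d : nat) (hd : (1 < d)%N)
    (F : groupType) (a : 'I_d -> F) :
  growth_rate R (basis_with_product hd a) <= beta R d.
Proof.
have b0 := beta_ge0 R hd; rewrite growth_rateE.
have [C [C0 ub]] := ball_upper_bound hd a R.
(* The constant factor in the ball bound has n-th roots tending to 1. *)
have lim_r : C `^ n%:R^-1 * beta R d @[n --> \oo] --> 1 * beta R d.
  by apply: cvgMr_tmp; exact: root_cvg1.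
rewrite -[leRHS]mul1r -(cvg_lim _ lim_r)//; apply: ler_lim.
- exact: growth_rate_cvg.
- by apply/cvg_ex; exists (1 * beta R d).
near=> n; have n0 : (0 < n)%N by near: n; exact: nbhs_infty_gt.
rewrite -[in leRHS](root_expr b0 n0) -powRM ?exprn_ge0 ?(ltW C0)//.
by apply: ge0_ler_powR; rewrite ?nnegrE ?invr_ge0 ?mulr_ge0 ?exprn_ge0 ?(ltW C0).
Unshelve. all: by end_near.
Qed.

Lemma growth_rate_ge (R : realType) (d : nat) (hd : (1 < d)%N)
    (F : groupType) (a : 'I_d -> F) (ha : free_basis a)
    (U : {fset F}) (hgen : generates U) (hcard : #|` U|%fset = d.+1)
    (hU : commuting_pair_free U) :
  beta R d <= growth_rate R U.
Proof.
have b0 := beta_ge0 R hd; rewrite growth_rateE.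
set L := limn _; have L_cvg : _ --> L := @growth_rate_cvg R F U.
have d0 : 0 < d%:R :> R by rewrite ltr0n ltnW.
have lim_r : d%:R `^ n%:R^-1 * (#|` ball_fset U n|%fset%:R : R) `^ n%:R^-1
    @[n --> \oo] --> 1 * L.
  by apply: cvgM => //; exact: root_cvg1.
rewrite -[leRHS]mul1r -(cvg_lim _ lim_r)//; apply: limr_ge.
  by apply/cvg_ex; exists (1 * L).
near=> n; have n0 : (0 < n)%N by near: n; exact: nbhs_infty_gt.
rewrite -[leLHS](root_expr b0 n0) -powRM //.
apply: ge0_ler_powR; rewrite ?nnegrE ?invr_ge0 ?mulr_ge0 ?exprn_ge0//.
exact: ball_lower_bound.
Unshelve. all: by end_near.
Qed.

End GrowthRate.

Local Open Scope fset_scope.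
Local Open Scope ring_scope.

Theorem proposition1p8 (R : realType) (d : nat) (hd : (1 < d)%N)
    (F : groupType) (a : 'I_d -> F) (ha : free_basis a)
    (U : {fset F}) (hgen : generates U) (hcard : #|` U| = d.+1)
    (hU : commuting_pair_free U) :
  growth_rate R (basis_with_product hd a) <= growth_rate R U.
Proof.
apply: le_trans (growth_rate_basis_with_product_le R hd a) _.
by apply: growth_rate_ge hgen hcard hU.
Qed.
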